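(* Let $I\subset\mathbb{R}_+^*$ be a symmetric and bounded interval, $I=[A^{-1},A]$ with $1<A<\infty$, and $\sqrt I=[A^{-1/2},A^{1/2}]$. There exists a compact operator $K_I$ in the Hilbert space $L^2(\sqrt I,d^*\rho)$ such that for any vector $\xi\in L^2(\sqrt I,d^*\rho)$ one has $$D\circ Q(\xi*\xi^* )=\langle\xi\mid(-2\,\mathrm{Id}+K_I)\xi\rangle=-2\|\xi\|^2+\langle\xi\mid K_I\,\xi\rangle .$$
   Context: $\mathbb{R}_+^*=(0,\infty)$ with Haar measure $d^*\rho=d\rho/\rho$; $(f*g)(u)=\int_0^\infty f(v)g(u/v)\,d^*v$, $\xi^*(u)=\overline{\xi(u^{-1})}$; elements of $L^2(\sqrt I,d^*\rho)$ are extended by $0$ outside $\sqrt I$; inner products are linear in the second variable. $Q=-(\rho\partial_\rho)^2+\frac14$. The functional $D$ is $D(f)=\int_0^\infty f(\rho^{-1})\,\delta(\rho)\,d^*\rho$, where $\delta$ is the function on $\mathbb{R}_+^*$ with $\delta(\rho^{-1})=\delta(\rho)$ and, for $\rho\ge1$, $$\delta(\rho)=2\rho^{\frac12}\left(\frac{\mathrm{Si}(2\pi(1+\rho))}{2\pi(1+\rho)}+\frac{\mathrm{Si}(2\pi(\rho-1))}{2\pi(\rho-1)}\right),\qquad \mathrm{Si}(z)=\int_0^z\frac{\sin t}{t}dt$$ ($\mathrm{Si}(z)/z$ taken to be $1$ at $z=0$). $D\circ Q(f)=D(Qf)$; for $\xi$ merely square integrable, $D\circ Q(\xi*\xi^*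 )$ is understood as the pairing $\int f(\rho^{-1})\,Q\delta(\rho)\,d^*\rho$ of the continuous compactly supported function $f=\xi*\xi^*$ with $Q\delta$, computed in the sense of distributions (a measure on $\mathbb{R}_+^*$). *)

(* Defs.v *)
From HB Require Import structures.
From mathcomp Require Import all_boot all_order all_algebra.
From mathcomp Require Import all_classical all_reals all_analysis.
From mathcomp Require Import measurable_realfun ring.
From mathcomp.real_closed Require Import complex.

Set Implicit Arguments.
Unset Strict Implicit.
Unset Printing Implicit Defensive.
Import Order.TTheory GRing.Theory Num.Theory.
Import numFieldNormedType.Exports.

Local Open Scope classical_set_scope.
Local Open Scope ring_scope.

(* The multiplicative group R_+^* is the subset [Rpos] of [R]; functions and
   measures on it are given on all of [R], and only their restriction to [Rpos]
   is ever used. *)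
Definition Rpos {R : realType} : set R := `]0, +oo[.

Definition haar_density {R : realType} (x : R) : R :=
  if 0 < x then x^-1 else 0.

Lemma haar_density_ge0 {R : realType} (x : R) : 0 <= haar_density x.
Proof. by rewrite /haar_density; case: ifPn => // /ltW; rewrite invr_ge0. Qed.

Lemma measurable_haar_density {R : realType} :
  measurable_fun setT (@haar_density R).
Proof.
apply: measurable_fun_if => //; first exact: measurable_fun_ltr.
have -> : [set: R] `&` (fun x => 0 < x) @^-1` [set true] = Rpos.
  by apply/seteqP; split=> x /=; rewrite /Rpos /= in_itv /= andbT; case.
apply: open_continuous_measurable_fun; first exact: interval_open.
move=> x /[!inE]; rewrite /Rpos /= in_itv /= andbT => x0.
by apply: cvgV; [rewrite gt_eqF|exact: cvg_id].
Qed.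

(* d^*x = dx / x, carried by ]0, +oo[. *)
Definition haar {R : realType} (A : set (measurableTypeR R)) : \bar R :=
  \int[lebesgue_measure]_(x in A) (haar_density x)%:E.

Section haar_is_measure.
Context {R : realType}.

Let haar0 : haar (set0 : set (measurableTypeR R)) = 0%E.
Proof. exact: integral_set0. Qed.

Let haar_ge0 (A : set (measurableTypeR R)) : (0 <= haar A)%E.
Proof. by apply: integral_ge0 => x _; rewrite lee_fin haar_density_ge0. Qed.

Let haar_sigma_additive : semi_sigma_additive (@haar R).
Proof.
apply: (@semi_sigma_additive_nng_induced _ _ _ lebesgue_measure).
  by apply/measurable_EFinP; exact: measurable_haar_density.
by move=> x; rewrite lee_fin haar_density_ge0.
Qed.

HB.instance Definition _ := isMeasure.Build _ _ _
  (@haar R) haar0 haar_ge0 haar_sigma_additive.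
End haar_is_measure.

(* Integral of a complex-valued function (meaningful when the real and
   imaginary parts are integrable). *)
Definition Cintegral d {T : measurableType d} {R : realType}
    (mu : {measure set T -> \bar R}) (D : set T) (f : T -> R[i]) : R[i] :=
  Complex (\int[mu]_(x in D) complex.Re (f x))
          (\int[mu]_(x in D) complex.Im (f x)).

Definition mulconv {R : realType} (f g : R -> R[i]) (u : R) : R[i] :=
  Cintegral haar Rpos (fun v => f v * g (u / v)).

Definition star {R : realType} (xi : R -> R[i]) (u : R) : R[i] :=
  conjc (xi u^-1).

Section distribution.
Context {R : realType}.
Implicit Types (f phi : R -> R)
  (mu nu : {measure set (measurableTypeR R) -> \bar R}).

(* Only used for [z >= 0].  The integrand is [0] instead of [1] at [t = 0],
   which does not affect the integral. *)
Definition Si (z : R) : R := \int[lebesgue_measure]_(t in `[0, z]) (sin t / t).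

Definition Si_quot (z : R) : R := if z == 0 then 1 else Si z / z.

Definition delta_ge1 (r : R) : R :=
  2 * Num.sqrt r * (Si_quot (2 * pi * (1 + r)) + Si_quot (2 * pi * (r - 1))).

Definition delta (r : R) : R :=
  if 1 <= r then delta_ge1 r else delta_ge1 r^-1.

Definition theta f : R -> R := fun r => r * f^`()%classic r.

Definition Qop f : R -> R := fun r => - theta (theta f) r + 4^-1 * f r.

Definition Dfun f : R := \int[haar]_(r in Rpos) (f r^-1 * delta r).

Definition test_function phi : Prop :=
  (forall n (x : R), derivable (phi^`(n)%classic) x 1) /\
  exists a b : R, 0 < a /\ forall x, ~~ (a <= x <= b) -> phi x = 0.

Definition locally_finite mu : Prop :=
  forall a b : R, 0 < a -> (mu `[a, b]%classic < +oo)%E.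

(* The real Radon measure [mu - nu] on ]0, +oo[ is the distribution
   [Q delta]; [Q] is formally self-adjoint for d^*r.  (Real-valued test
   functions suffice as [delta] is real-valued.) *)
Definition is_Qdelta mu nu : Prop :=
  [/\ locally_finite mu, locally_finite nu &
      forall phi, test_function phi ->
        \int[mu]_(r in Rpos) phi r - \int[nu]_(r in Rpos) phi r =
        \int[haar]_(r in Rpos) (delta r * Qop phi r)].

(* The pairing of [f(1/r)] with the measure [mu - nu]. *)
Definition DQ mu nu (f : R -> R[i]) : R[i] :=
  Cintegral mu Rpos (fun r => f r^-1) - Cintegral nu Rpos (fun r => f r^-1).

End distribution.

(* On test functions the pairing above is the functional f |-> D (Q f). *)
Section consistency.
Context {R : realType} (phi : R -> R) (test_phi : test_function phi).

Let vanish : exists a b : R, [/\ 0 < a, 0 < b &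
  forall n (x : R), x < a \/ b < x -> phi^`(n)%classic x = 0].
Proof.
case: test_phi => _ [a [b [a0 phi0]]].
exists a, (Num.max b 1); split=> //; first by rewrite lt_max ltr01 orbT.
have phiout x : x < a \/ Num.max b 1 < x -> phi x = 0.
  move=> xab; apply: phi0; case: xab => [xa|]; first by rewrite leNgt xa.
  by rewrite gt_max => /andP[bx _]; rewrite (leNgt x b) bx andbF.
elim=> [|n IH] x xab; first exact: phiout.
rewrite derive1nS derive1E (@near_eq_derive _ _ _ _ (cst 0)) ?derive_cst//.
case: xab => xab.
- by near=> y; apply: IH; left; near: y; exact: lt_nbhsl.
- by near=> y; apply: IH; right; near: y; exact: lt_nbhsr.
Unshelve. all: by end_near. Qed.

Inductive inv_class : (R -> R) -> Prop :=
| inv_class_base n k : inv_class (fun x => phi^`(n)%classic x^-1 * x^-1 ^+ k)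
| inv_class_lin (c d : R) g h : inv_class g -> inv_class h ->
    inv_class (fun x => c * g x + d * h x).

Let base_derive (n k : nat) (x : R) : is_derive x 1
  (fun x : R => phi^`(n)%classic x^-1 * x^-1 ^+ k)
  (- 1 * (phi^`(n.+1)%classic x^-1 * x^-1 ^+ k.+2) +
   - k%:R * (phi^`(n)%classic x^-1 * x^-1 ^+ k.+1)).
Proof.
have [x0|x0] := ltP 0 x.
  have dphi : is_derive x^-1 1 (phi^`(n)%classic) (phi^`(n.+1)%classic x^-1).
    rewrite derive1nS derive1E; apply: DeriveDef => //.
    by case: test_phi => + _; exact.
  have dinv : is_derive x 1 (fun y : R => y^-1) (- (x ^- 2)).
    have := @is_deriveV R id x 1 1 (lt0r_neq0 x0) (is_derive_id x 1).
    by rewrite /GRing.scale/= mulr1.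
  have d1 := @is_derive1_comp R _ _ x _ _ dphi dinv.
  have d2 := @is_deriveX R R (fun y : R => y^-1) k x 1 _ dinv.
  have d12 := is_deriveM d1 d2.
  rewrite (_ : (fun _ => _) =
      (phi^`(n)%classic \o GRing.inv) * (fun y : R => y^-1) ^+ k); last first.
    by apply/funext => y; rewrite mulrfctE exprfctE.
  apply: (is_derive_eq d12); rewrite exprfctE /GRing.scale/= -!exprVn.
  case: k {d2 d12} => [|k].
    by rewrite !exprS !expr0; ring.
  by rewrite !exprS /=; ring.
have [a [b [a0 b0 out]]] := vanish.
have zero n' k' (y : R) : y < b^-1 -> phi^`(n')%classic y^-1 * y^-1 ^+ k' = 0.
  move=> yb; rewrite out ?mul0r//.
  have [y0|y0] := ltP 0 y.
    by right; rewrite -(invrK b) ltf_pV2 ?posrE ?invr_gt0.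
  by left; rewrite (le_lt_trans _ a0)// invr_le0.
have xb : x < b^-1 by rewrite (le_lt_trans x0)// invr_gt0.
rewrite !zero// !mulr0 addr0.
apply: (@near_eq_is_derive _ _ _ (cst 0)).
by near=> y; rewrite zero//; near: y; exact: lt_nbhsl.
Unshelve. all: by end_near. Qed.

Let inv_class_derive (g : R -> R) : inv_class g ->
  (forall x : R, derivable g x 1) /\ inv_class g^`()%classic.
Proof.
elim=> [n k|c d f h _ [df cf] _ [dh ch]].
  split=> [x|]; first by case: (base_derive n k x).
  rewrite (_ : _^`()%classic = (fun x =>
    - 1 * (phi^`(n.+1)%classic x^-1 * x^-1 ^+ k.+2) +
    - k%:R * (phi^`(n)%classic x^-1 * x^-1 ^+ k.+1))).
    by apply: inv_class_lin; exact: inv_class_base.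
  by apply/funext => x; rewrite derive1E; case: (base_derive n k x).
have dfh (x : R) : is_derive x 1 (fun x => c * f x + d * h x)
    (c * f^`()%classic x + d * h^`()%classic x).
  rewrite !derive1E.
  by apply: is_deriveD; apply: is_deriveZ; exact: DeriveDef.
split=> [x|]; first by case: (dfh x).
rewrite (_ : _^`()%classic =
  (fun x => c * f^`()%classic x + d * h^`()%classic x)).
  exact: inv_class_lin.
by apply/funext => x; rewrite derive1E; case: (dfh x).
Qed.

Let test_inv : test_function (fun x => phi x^-1).
Proof.
split.
  have base : inv_class (fun x => phi x^-1).
    rewrite (_ : (fun _ => _) = (fun x => phi^`(0)%classic x^-1 * x^-1 ^+ 0)).
      exact: inv_class_base.
    by apply/funext => x; rewrite expr0 mulr1.
  suff cls n : inv_class (fun x => phi x^-1)^`(n)%classic.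
    by move=> n x; have [+ _] := inv_class_derive (cls n); exact.
  elim: n => [//|n IH]; rewrite derive1nS.
  by have [] := inv_class_derive IH.
have [a [b [a0 b0 out]]] := vanish.
exists b^-1, a^-1; split; first by rewrite invr_gt0.
move=> x; rewrite negb_and -!ltNge => xab; apply: (out 0%N).
have [x0|x0] := ltP 0 x; last first.
  by left; rewrite (le_lt_trans _ a0)// invr_le0.
case/orP: xab => xab; [right|left].
  by rewrite -(invrK b) ltf_pV2 ?posrE ?invr_gt0.
by rewrite -(invrK a) ltf_pV2 ?posrE ?invr_gt0.
Qed.

Let Qop_inv r : 0 < r -> Qop (fun x => phi x^-1) r = Qop phi r^-1.
Proof.
move=> r0; have dphi n x := (test_phi.1 n x).
have E1 : theta (fun x => phi x^-1) =
    fun x => - (phi^`(1)%classic x^-1 * x^-1 ^+ 1).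
  apply/funext => x; rewrite /theta derive1E.
  have [_] := base_derive 0 0 x.
  under eq_fun do rewrite expr0 mulr1.
  move=> ->; rewrite oppr0 mul0r addr0 expr1.
  have [->|x0] := eqVneq x 0; first by rewrite invr0 !mul0r mulr0 oppr0.
  by rewrite !exprS expr0 mulr1 mulN1r mulrN; congr (- _); field.
rewrite /Qop E1 {1}/theta derive1E.
have /(is_deriveN) [_ ->] := base_derive 1 1 r.
have [s s0 rs] : exists2 s, s != 0 & r = s^-1.
  by exists r^-1; rewrite ?invrK// invr_eq0 gt_eqF.
rewrite rs invrK /theta.
have -> : (fun x => x * phi^`()%classic x)^`()%classic s =
    phi^`(1)%classic s + s * phi^`(2)%classic s.
  rewrite derive1E deriveM//; last exact: (dphi 1%N).
  rewrite derive_id /GRing.scale/= mulr1 addrC; congr (_ + _).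
  by rewrite -derive1E.
by rewrite !exprS expr0; field.
Qed.

Lemma DQ_test (mu nu : {measure set (measurableTypeR R) -> \bar R}) :
  is_Qdelta mu nu ->
  DQ mu nu (fun r => real_complex R (phi r)) = real_complex R (Dfun (Qop phi)).
Proof.
case=> _ _ /(_ _ test_inv) E.
have zero (m : {measure set (measurableTypeR R) -> \bar R}) :
    \int[m]_(r in Rpos) (0 : R) = 0 :> R.
  by rewrite /Rintegral integral0.
rewrite /DQ /Cintegral /= !zero; apply/eqP; rewrite eq_complex /= subrr eqxx.
rewrite andbT E /Dfun; apply/eqP; apply: eq_Rintegral => r.
by rewrite inE /Rpos /= in_itv /= andbT => r0; rewrite Qop_inv// mulrC.
Qed.

End consistency.

Section hilbert.
Context {R : realType}.
Implicit Types (A : R) (xi eta : R -> R[i]) (K : (R -> R[i]) -> (R -> R[i])).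

Definition sqrtI A : set R := `[(Num.sqrt A)^-1, Num.sqrt A].

(* Representatives of the elements of L^2(sqrt I, d^*r), I = [1/A, A], extended
   by 0 outside sqrt I; two of them are the same vector when they are equal
   almost everywhere. *)
Definition L2 A xi : Prop :=
  [/\ (fun x => complex.Re (xi x)) \in Lfun (@haar R) 2%:E,
      (fun x => complex.Im (xi x)) \in Lfun (@haar R) 2%:E &
      forall x, ~ sqrtI A x -> xi x = 0].

Definition inner xi eta : R[i] :=
  Cintegral haar Rpos (fun x => conjc (xi x) * eta x).

Definition L2norm xi : R := Num.sqrt (complex.Re (inner xi xi)).

Definition ae_equal xi eta : Prop := {ae haar, forall x, xi x = eta x}.

(* A linear operator on L^2(sqrt I), given on representatives. *)
Definition L2_operator A K : Prop :=
  [/\ forall xi, L2 A xi -> L2 A (K xi),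
      forall xi eta, L2 A xi -> L2 A eta ->
        ae_equal xi eta -> ae_equal (K xi) (K eta) &
      forall (c : R[i]) xi eta, L2 A xi -> L2 A eta ->
        ae_equal (K (fun x => c * xi x + eta x))
                 (fun x => c * K xi x + K eta x)].

(* Every bounded sequence has a subsequence whose image converges. *)
Definition compact_operator A K : Prop :=
  L2_operator A K /\
  forall xi : nat -> R -> R[i],
    (forall n, L2 A (xi n)) -> (exists M : R, forall n, L2norm (xi n) <= M) ->
    exists (s : nat -> nat) (eta : R -> R[i]),
      [/\ {homo s : m n / (m < n)%N}, L2 A eta &
          L2norm (fun x => K (xi (s n)) x - eta x) @[n --> \oo] --> (0 : R)].

End hilbert.

(* Main.v *)
Require Import Defs.
From HB Require Import structures.
From mathcomp Require Import all_boot all_order all_algebra.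
From mathcomp Require Import all_classical all_reals all_analysis.
From mathcomp Require Import measurable_realfun ring lra.
From mathcomp.real_closed Require Import complex.
Import Order.TTheory GRing.Theory Num.Theory.
Import numFieldNormedType.Exports.

(** In the variable t = ln r, the function delta is t |-> G(|t|) with G of
    class C^2 on the whole line, because Si(z)/z is an entire function of z.
    The only singularity of delta is therefore a corner at r = 1, and
      Q delta = - 2 G'(0) delta_1 + P(|ln r|) d^*r,   P = - G'' + G/4.
    The terms in Si(4 pi) cancel in G'(0), thanks to sin(4 pi) = 0, and
    G'(0) = 1 ([ldelta10]).  So Q delta is minus twice a point mass at 1 plus
    a locally bounded density q ([is_Qdelta_reference]); Green's identity on
    each side of 1 ([green_identity]) produces the point mass.

    Pairing f(1/r), f = xi * xi^*, with the point mass gives f(1) = ||xi||^2,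
    whence -2 ||xi||^2.  Pairing it with the density q gives, by Fubini's
    theorem and the invariance of d^*r ([integral_corr_Qdelta]), the quadratic
    form of
      (K xi)(w) = int q(w/v) xi(v) d^*v,   w in sqrt I.
    As w/v stays in the compact I when v and w run through sqrt I, where q is
    uniformly continuous, K maps a bounded sequence to a uniformly bounded and
    equicontinuous one.  The argument of Arzela and Ascoli
    ([uniform_subsequence]) extracts a uniformly convergent subsequence, which
    converges in L^2 because sqrt I has finite measure; so K is compact.

    The measures mu, nu representing Q delta are arbitrary.  The pairing does
    not depend on them ([Qdelta_unique]): increasing sequences of test
    functions, products of exp(-1/x)-type bumps, converge pointwise to the
    indicators of open intervals, so any two differences mu - nu and
    mu' - nu' agree on open intervals, hence on Borel sets of ]0, +oo[.  This
    covers xi merely square integrable, since f is Borel, bounded by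
    2 ||xi||^2 and supported in I ([bdd_supp_corr]).

    Everything is done for real functions; the real and imaginary parts of xi
    are combined at the end. *)

Set Implicit Arguments.
Unset Strict Implicit.
Unset Printing Implicit Defensive.

Local Open Scope classical_set_scope.
Local Open Scope ring_scope.

(** * Entire power series and the function Si(z)/z *)

Section power_series.
Context {R : realType}.
Implicit Types (f : nat -> R) (x z : R).

(** This bound is stable under formal differentiation, so one hypothesis gives
    derivatives of all orders. *)
Definition entire_coeff f := forall n, `|f n| <= (n`!%:R)^-1.

Definition psum f x : R := limn (pseries f x).

Lemma is_cvg_psum f x : entire_coeff f -> cvgn (pseries f x).
Proof.
move=> fle; apply: normed_cvg.
apply: series_le_cvg; last exact: (is_cvg_series_exp_coeff `|x|).
- by move=> n; rewrite normr_ge0.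
- by move=> n; rewrite divr_ge0.
- move=> n /=; rewrite /exp_coeff /= normrM normrX mulrC.
  by rewrite ler_wpM2l ?exprn_ge0.
Qed.

Lemma entire_coeff_diffs f : entire_coeff f -> entire_coeff (pseries_diffs f).
Proof.
move=> fle n; rewrite /pseries_diffs normrM normr_nat.
rewrite (le_trans (ler_wpM2l _ (fle n.+1)))//.
by rewrite factS natrM invfM mulVKf.
Qed.

Lemma is_derive_psum f x : entire_coeff f ->
  is_derive x 1 (psum f) (psum (pseries_diffs f) x).
Proof.
move=> fle; apply: (@pseries_snd_diffs _ _ (`|x| + 1)).
- exact: is_cvg_psum.
- exact/is_cvg_psum/entire_coeff_diffs.
- exact/is_cvg_psum/entire_coeff_diffs/entire_coeff_diffs.
- by rewrite [ltRHS]ger0_norm ?addr_ge0// ltrDl.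
Qed.

Lemma psum0 f : psum f 0 = f 0%N.
Proof.
rewrite /psum /pseries; apply: lim_near_cst => //.
near=> n; rewrite /series /= -(@prednK n); last by near: n; exists 1%N.
rewrite big_nat_recl //= expr0 mulr1 big1 ?addr0 // => i _.
by rewrite exprS mul0r mulr0.
Unshelve. all: by end_near. Qed.

(** The Taylor coefficients of sin z / z. *)
Definition sinc_coeff (n : nat) : R :=
  (odd n.+1)%:R * (-1) ^+ (n.+1.-1)./2 * (n.+1`!%:R)^-1.

(** The Taylor coefficients of Si(z) / z, integrated term by term. *)
Definition Siq_coeff (n : nat) : R := sinc_coeff n / n.+1%:R.

Lemma entire_sinc_coeff : entire_coeff sinc_coeff.
Proof.
move=> n; rewrite /sinc_coeff !normrM normrX normrN1 expr1n mulr1.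
rewrite normfV !normr_nat.
apply: (@le_trans _ _ (n.+1`!%:R)^-1).
  by rewrite ler_piMl// lern1 leq_b1.
by rewrite lef_pV2 ?posrE ?ltr0n ?fact_gt0// ler_nat leq_fact.
Qed.

Lemma entire_Siq_coeff : entire_coeff Siq_coeff.
Proof.
move=> n; rewrite /Siq_coeff normrM normfV normr_nat.
rewrite (le_trans _ (entire_sinc_coeff n))// ler_piMr// invf_le1//.
by rewrite ler1n.
Qed.

Definition sinc : R -> R := psum sinc_coeff.

Lemma sincE x : x * sinc x = sin x.
Proof.
rewrite sinE /sinc /psum; apply/esym.
have cs := is_cvg_psum (x := x) entire_sinc_coeff.
apply: cvg_lim => //; rewrite -(cvg_shiftn 1)/=.
set u := (X in X @ \oo --> _).
have -> : u = (fun n => x *: pseries sinc_coeff x n).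
  apply/funext => n; rewrite /u addn1 /pseries /series /= big_nat_recl//=.
  rewrite !mul0r add0r /GRing.scale/= mulr_sumr; apply: eq_bigr => i _.
  by rewrite exprS mulrCA.
exact: cvgZl_tmp.
Qed.

Definition Siq : R -> R := psum Siq_coeff.
Definition Siq1 : R -> R := psum (pseries_diffs Siq_coeff).
Definition Siq2 : R -> R := psum (pseries_diffs (pseries_diffs Siq_coeff)).

Lemma is_derive_Siq x : is_derive x 1 Siq (Siq1 x).
Proof. exact/is_derive_psum/entire_Siq_coeff. Qed.

Lemma is_derive_Siq1 x : is_derive x 1 Siq1 (Siq2 x).
Proof. exact/is_derive_psum/entire_coeff_diffs/entire_Siq_coeff. Qed.

Definition Siq3 : R -> R :=
  psum (pseries_diffs (pseries_diffs (pseries_diffs Siq_coeff))).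

Lemma is_derive_Siq2 x : is_derive x 1 Siq2 (Siq3 x).
Proof.
exact/is_derive_psum/entire_coeff_diffs/entire_coeff_diffs/entire_Siq_coeff.
Qed.

(** This is (z S(z))' = sin z / z for S(z) = Si(z) / z, compared coefficient by
    coefficient. *)
Lemma Siq_sinc x : Siq x + x * Siq1 x = sinc x.
Proof.
have cS := is_cvg_psum (x := x) entire_Siq_coeff.
have cS1 := is_cvg_psum (x := x) (entire_coeff_diffs entire_Siq_coeff).
rewrite /Siq /Siq1 /sinc /psum -[x * _]/(x *: _).
have shift : pseries (fun n => n%:R * Siq_coeff n) x @ \oo -->
    x *: limn (pseries (pseries_diffs Siq_coeff) x).
  rewrite -(cvg_shiftn 1)/=.
  have -> : (fun n => pseries (fun n => n%:R * Siq_coeff n) x (n + 1)%N)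
     = (fun n => x *: pseries (pseries_diffs Siq_coeff) x n).
    apply/funext => n; rewrite addn1 /pseries /series /= big_nat_recl//=.
    rewrite !mul0r add0r /GRing.scale/= mulr_sumr; apply: eq_bigr => i _.
    by rewrite exprS mulrCA.
  exact: cvgZl_tmp.
apply/esym/cvg_lim => //.
have -> : pseries sinc_coeff x =
    pseries Siq_coeff x + pseries (fun n => n%:R * Siq_coeff n) x.
  apply/funext => n; rewrite /pseries /series /= fctE /= -big_split/=.
  apply: eq_bigr => i _; rewrite /Siq_coeff -mulrDl; congr (_ * _).
  by field; rewrite (_ : 1 + i%:R = i.+1%:R) ?pnatr_eq0// -natr1 addrC.
exact: cvgD.
Qed.

Lemma Siq0 : Siq 0 = 1.
Proof. by rewrite /Siq psum0 /Siq_coeff /sinc_coeff/= !(expr0, mul1r, mulr1, invr1). Qed.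

Lemma Siq10 : Siq1 0 = 0.
Proof. by rewrite /Siq1 psum0 /pseries_diffs /Siq_coeff /sinc_coeff/= !(mul0r, mulr0). Qed.

Lemma is_derive_mulSiq x : is_derive x 1 (fun x => x * Siq x) (sinc x).
Proof.
have h := is_deriveM (is_derive_id x (1 : R)) (is_derive_Siq x).
rewrite (_ : (fun x => x * Siq x) = id * Siq)// -Siq_sinc.
apply: (is_derive_eq h).
by rewrite /GRing.scale/= mulr1 addrC.
Qed.

(** By [Siq_sinc], z S(z) is a primitive of sin z / z vanishing at 0. *)
Lemma Si_quotE z : 0 <= z -> Si_quot z = Siq z.
Proof.
move=> z0; rewrite /Si_quot; case: eqVneq => [->|zn0]; first by rewrite Siq0.
have {}z0 : 0 < z by rewrite lt_neqAle eq_sym zn0.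
apply: (mulfI zn0); rewrite mulrCA divff// mulr1 /Si.
have cs : continuous sinc.
  move=> x; apply/differentiable_continuous/derivable1_diffP.
  by have [] := is_derive_psum x entire_sinc_coeff.
have sincE' : {in `]0%R, z], sinc =1 (fun t => sin t / t)}.
  move=> x; rewrite in_itv/= => /andP[x0 _].
  by rewrite -sincE mulrAC divff ?mul1r// gt_eqF.
have isinc : lebesgue_measure.-integrable `]0, z] (EFin \o sinc).
  apply: (@integrableS _ _ _ lebesgue_measure `[0, z]) => //.
    exact: subset_itv_oc_cc.
  apply: continuous_compact_integrable; first exact: segment_compact.
  exact: continuous_subspaceT.
(* The integrand differs from sinc at 0, where division by 0 makes it 0. *)
rewrite -Rintegral_itv_obnd_cbnd; last first.
  apply: eq_integrable isinc => // x; rewrite inE => xz /=.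
  by rewrite sincE'.
transitivity (\int[lebesgue_measure]_(t in `]0%R, z]) sinc t)%R.
  by apply: eq_Rintegral => x; rewrite inE/= => xz; rewrite sincE'.
rewrite Rintegral_itv_obnd_cbnd//.
rewrite /Rintegral (@continuous_FTC2 _ _ (fun x => x * Siq x))//=.
- by rewrite mul0r subr0.
- exact: continuous_subspaceT.
- have ct : continuous (fun x => x * Siq x).
    move=> x; apply/differentiable_continuous/derivable1_diffP.
    by case: (is_derive_mulSiq x).
  split.
  + by move=> x _; case: (is_derive_mulSiq x).
  + exact/cvg_at_right_filter/ct.
  + exact/cvg_at_left_filter/ct.
- by move=> x _; rewrite derive1E; case: (is_derive_mulSiq x).
Qed.

End power_series.

(** * Differentiation rules and the fundamental theorem of calculus *)

Section derive_pointwise.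
Context {R : realType}.
Implicit Types (f g : R -> R) (x a b : R).

Lemma is_derive1M f g x a b : is_derive x 1 f a -> is_derive x 1 g b ->
  is_derive x 1 (fun y => f y * g y) (a * g x + f x * b).
Proof.
move=> df dg; have d := is_deriveM df dg.
rewrite (_ : (fun y => f y * g y) = f * g)//; apply: (is_derive_eq d).
by rewrite /GRing.scale/= addrC (mulrC a).
Qed.

Lemma is_derive1D f g x a b : is_derive x 1 f a -> is_derive x 1 g b ->
  is_derive x 1 (fun y => f y + g y) (a + b).
Proof. by move=> df dg; exact: is_deriveD. Qed.

Lemma is_derive1_compE f g x a b : is_derive (g x) 1 f a -> is_derive x 1 g b ->
  is_derive x 1 (fun y => f (g y)) (a * b).
Proof. exact: is_derive1_comp. Qed.

Lemma is_derive1_mull f x a b : is_derive x 1 f a ->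
  is_derive x 1 (fun y => b * f y) (b * a).
Proof. exact: (@is_deriveZ _ _ _ f b x 1 a). Qed.

Lemma is_derive1_continuous f x a : is_derive x 1 f a -> {for x, continuous f}.
Proof. by case=> df _; exact/differentiable_continuous/derivable1_diffP. Qed.

Lemma is_derive1_compZ f (k x a : R) : is_derive (k * x) 1 f a ->
  is_derive x 1 (fun y => f (k * y)) (k * a).
Proof.
move=> df; rewrite mulrC; apply: (is_derive1_compE (g := fun y => k * y) df).
rewrite -[X in is_derive _ _ _ X]mulr1.
exact: (is_derive1_mull k (is_derive_id x 1)).
Qed.

Lemma FTC2_is_derive (f F : R -> R) a b : a < b ->
  {in `[a, b], forall x, {for x, continuous f}} ->
  {in `[a, b], forall x, is_derive x 1 F (f x)} ->
  (\int[lebesgue_measure]_(x in `[a, b]) f x)%R = F b - F a.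
Proof.
move=> ab cf dF; rewrite /Rintegral (@continuous_FTC2 _ _ F)//.
- apply: continuous_in_subspaceT => x; rewrite inE/= => xab; exact: cf.
- split.
  + by move=> x xab; have [] := dF x (subset_itv_oo_cc xab).
  + apply/cvg_at_right_filter/is_derive1_continuous/dF.
    by rewrite in_itv/= lexx ltW.
  + apply/cvg_at_left_filter/is_derive1_continuous/dF.
    by rewrite in_itv/= lexx ltW.
- by move=> x xab; rewrite derive1E; have [] := dF x (subset_itv_oo_cc xab).
Qed.
End derive_pointwise.


(** * The function delta in the logarithmic variable *)

Section log_delta.
Context {R : realType}.
Implicit Types (x t : R).

Let c : R := 2 * pi.

Let h x := Siq (c * (1 + x)) + Siq (c * (x - 1)).
Let h1 x := c * (Siq1 (c * (1 + x)) + Siq1 (c * (x - 1))).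
Let h2 x := c ^+ 2 * (Siq2 (c * (1 + x)) + Siq2 (c * (x - 1))).

Let is_derive_affine (f : R -> R) (b x a : R) :
  is_derive (c * (b + x)) 1 f a ->
  is_derive x 1 (fun y => f (c * (b + y))) (c * a).
Proof.
move=> df; rewrite [c * a]mulrC.
apply: (is_derive1_compE (g := fun y => c * (b + y)) df).
rewrite -[X in is_derive _ _ _ X]mulr1; apply: is_derive1_mull.
rewrite -[X in is_derive _ _ _ X]add0r.
exact: is_derive1D.
Qed.

Let dh x : is_derive x 1 h (h1 x).
Proof.
rewrite /h /h1 mulrDr.
under eq_fun do rewrite [_ - 1]addrC.
rewrite [x - 1]addrC.
by apply: is_derive1D; apply: is_derive_affine; exact: is_derive_Siq.
Qed.

Let dh1 x : is_derive x 1 h1 (h2 x).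
Proof.
rewrite /h1 /h2 expr2 -mulrA mulrDr; apply: is_derive1_mull.
under eq_fun do rewrite [_ - 1]addrC.
rewrite [x - 1]addrC.
by apply: is_derive1D; apply: is_derive_affine; exact: is_derive_Siq1.
Qed.

Let h3 x := c ^+ 3 * (Siq3 (c * (1 + x)) + Siq3 (c * (x - 1))).

Let dh2 x : is_derive x 1 h2 (h3 x).
Proof.
rewrite /h2 /h3 (exprSr c 2) -mulrA mulrDr; apply: is_derive1_mull.
under eq_fun do rewrite [_ - 1]addrC.
rewrite [x - 1]addrC.
by apply: is_derive1D; apply: is_derive_affine; exact: is_derive_Siq2.
Qed.

(** It is delta (exp t) for t >= 0, continued analytically to t < 0. *)
Definition ldelta t : R := 2 * expR (2^-1 * t) * h (expR t).
Definition ldelta1 t : R :=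
  expR (2^-1 * t) * (h (expR t) + 2 * (expR t * h1 (expR t))).
Definition ldelta2 t : R :=
  expR (2^-1 * t) * (2^-1 * h (expR t) + 4 * (expR t * h1 (expR t)) +
                     2 * (expR t * (expR t * h2 (expR t)))).

Let dhalf t : is_derive t 1 (fun t => expR (2^-1 * t)) (2^-1 * expR (2^-1 * t)).
Proof. exact: is_derive1_compZ (is_derive_expR _). Qed.

Let dhe t : is_derive t 1 (fun t => h (expR t)) (h1 (expR t) * expR t).
Proof. exact: is_derive1_compE (dh _) (is_derive_expR t). Qed.

Let dh1e t : is_derive t 1 (fun t => h1 (expR t)) (h2 (expR t) * expR t).
Proof. exact: is_derive1_compE (dh1 _) (is_derive_expR t). Qed.

Lemma is_derive_ldelta t : is_derive t 1 ldelta (ldelta1 t).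
Proof.
apply: (is_derive_eq (is_derive1M (is_derive1_mull 2 (dhalf t)) (dhe t))).
rewrite /ldelta1; move: (h _) (h1 _) (expR (_ * t)) => u v w; by field.
Qed.

Lemma is_derive_ldelta1 t : is_derive t 1 ldelta1 (ldelta2 t).
Proof.
have d := is_derive1D (dhe t) (is_derive1_mull 2
  (is_derive1M (is_derive_expR t) (dh1e t))).
apply: (is_derive_eq (is_derive1M (dhalf t) d)).
rewrite /ldelta2; move: (h _) (h1 _) (h2 _) (expR (_ * t)) => u v w z; by field.
Qed.

Lemma continuous_ldelta2 : continuous ldelta2.
Proof.
move=> t; rewrite /ldelta2.
have e := @continuous_expR R t.
have che : {for t, continuous (fun t => h2 (expR t))}.
  exact: is_derive1_continuous (is_derive1_compE (dh2 _) (is_derive_expR t)).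
apply: cvgM; first exact: is_derive1_continuous (dhalf t).
apply: cvgD; first apply: cvgD.
- by apply: cvgM; [exact: cvg_cst|exact: is_derive1_continuous (dhe t)].
- apply: cvgM; [exact: cvg_cst|apply: cvgM => //].
  exact: is_derive1_continuous (dh1e t).
- by apply: cvgM; [exact: cvg_cst|apply: cvgM => //; apply: cvgM].
Qed.

(** G'(0) = S(4 pi) + 4 pi S'(4 pi) + 1 with S(z) = Si(z) / z, and the first two
    terms sum to sinc (4 pi) = 0. *)
Lemma ldelta10 : ldelta1 0 = 1.
Proof.
rewrite /ldelta1 mulr0 expR0 mul1r mul1r /h /h1 subrr mulr0 Siq0 Siq10 addr0.
rewrite [2 * _]mulrA (mulrC 2) (_ : 1 + 1 = 2)// addrAC -/c.
rewrite (Siq_sinc (c * 2)).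
rewrite (_ : sinc (c * 2) = 0) ?add0r//.
apply: (@mulfI _ (c * 2)); first by rewrite !mulf_neq0// gt_eqF// pi_gt0.
rewrite sincE mulr0 /c (_ : 2 * pi * 2 = pi *+ 2 + pi *+ 2); last by ring.
by rewrite sinD sin2pi mul0r mulr0 addr0.
Qed.

Lemma delta_ge1E x : 1 <= x -> delta_ge1 x = ldelta (ln x).
Proof.
move=> x1; have x0 : 0 < x by rewrite (lt_le_trans _ x1).
rewrite /delta_ge1 /ldelta lnK// -/c !Si_quotE.
- rewrite /h; congr (2 * _ * _).
  rewrite -[in LHS](lnK x0); apply: (@pexpIrn _ 2) => //.
  + by rewrite nnegrE sqrtr_ge0.
  + by rewrite nnegrE expR_ge0.
  + rewrite sqr_sqrtr ?expR_ge0// -expRM_natl.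
    by rewrite mulrA divff ?mul1r.
- by rewrite mulr_ge0 ?subr_ge0// mulr_ge0// pi_ge0.
- by rewrite mulr_ge0 ?addr_ge0 ?mulr_ge0 ?pi_ge0// ltW.
Qed.

Lemma deltaE x : 0 < x -> delta x = ldelta `|ln x|.
Proof.
move=> x0; rewrite /delta; case: ifPn => [x1|].
  by rewrite delta_ge1E// ger0_norm// ln_ge0.
rewrite -ltNge => x1; rewrite delta_ge1E ?lnV//; last by rewrite invf_ge1// ltW.
by rewrite ltr0_norm// ln_lt0// x0.
Qed.

(** The pointwise value of Q delta off the point 1, in the variable ln x. *)
Definition lQdelta t : R := 4^-1 * ldelta t - ldelta2 t.

Lemma continuous_lQdelta : continuous lQdelta.
Proof.
move=> t; apply: cvgB; last exact: continuous_ldelta2.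
apply: cvgM; first exact: cvg_cst.
exact: is_derive1_continuous (is_derive_ldelta t).
Qed.

End log_delta.

(** * Measures with a density *)

Section density.
Local Open Scope ereal_scope.
Context d (T : measurableType d) (R : realType).
Variables (m nu : {measure set T -> \bar R}) (h : T -> R).
Hypotheses (mh : measurable_fun setT h) (h0 : forall x, (0 <= h x)%R).
Hypothesis nuE : forall A, measurable A -> nu A = \int[m]_(x in A) (h x)%:E.

Import HBNNSimple.

(** Monotone approximation by simple functions reduces this to indicators, for
    which it is the hypothesis on nu. *)
Lemma ge0_integral_density D (f : T -> \bar R) :
  measurable D -> measurable_fun D f -> {in D, forall y, 0 <= f y} ->
  \int[nu]_(y in D) f y = \int[m]_(y in D) (f y * (h y)%:E).
Proof.
move=> mD mf f0.
pose f_ := nnsfun_approx mD mf.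
transitivity (limn (fun n => \int[nu]_(x in D) (f_ n x)%:E)).
  rewrite -monotone_convergence//.
  - apply: eq_integral => y /[!inE] yD; apply/esym/cvg_lim => //.
    by apply: cvg_nnsfun_approx=> // *; apply: f0; rewrite inE.
  - by move=> n; exact/measurable_EFinP/measurable_funP.
  - by move=> n y _; rewrite lee_fin.
  - by move=> y _ k n kn; rewrite lee_fin; exact/lefP/nd_nnsfun_approx.
rewrite [X in limn X](_ : _ =
    (fun n => \int[m]_(x in D) ((f_ n x)%:E * (h x)%:E))).
  rewrite -monotone_convergence//; last 3 first.
    - move=> n /=; apply: emeasurable_funM.
        exact/measurable_EFinP/measurable_funTS.
      exact/measurable_EFinP/measurable_funTS.
    - by move=> n x _ /=; rewrite mule_ge0// lee_fin.
    - move=> x _ k n kn; rewrite lee_wpmul2r ?lee_fin//.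
      exact/lefP/nd_nnsfun_approx.
  apply: eq_integral => x /[!inE] Dx /=; apply/cvg_lim => //.
  apply: cvgeMr => //.
  by apply: cvg_nnsfun_approx=> // y Dy; apply: f0; rewrite inE.
apply/funext => n.
have mpre r : measurable (f_ n @^-1` [set r]) by exact: measurable_sfunP.
transitivity (\sum_(k \in range (f_ n))
    \int[m]_(x in D) (k * \1_(f_ n @^-1` [set k]) x * h x)%:E).
  under eq_integral do rewrite fimfunE -fsumEFin//.
  rewrite ge0_integral_fsum//; last 2 first.
  - by move=> y; exact/measurable_EFinP/measurable_funM.
  - by move=> y x _; rewrite nnfun_muleindic_ge0.
  apply: eq_fsbigr => r _; rewrite integralZl_indic_nnsfun// integral_indic//=.
  rewrite nuE; last exact: measurableI.
  have [r0|r0] := ltP r 0%R.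
    rewrite preimage_nnfun0// set0I integral_set0 mule0 integral0_eq// => x _.
    by rewrite indicE in_set0 mulr0 mul0r.
  transitivity (r%:E * \int[m]_(x in D) ((\1_(f_ n @^-1` [set r]) x * h x)%:E)).
    congr (_ * _); rewrite setIC integral_mkcondr; apply: eq_integral => x _.
    by rewrite patchE indicE; case: ifPn; rewrite ?mul1r ?mul0r.
  rewrite -ge0_integralZl//.
  - by apply: eq_integral => x _; rewrite -EFinM mulrA.
  - apply/measurable_EFinP/measurable_funM; last exact: measurable_funTS.
    exact/measurable_funTS/measurable_indic.
  - by move=> x _; rewrite lee_fin mulr_ge0.
rewrite -ge0_integral_fsum//.
- apply: eq_integral => x _; rewrite fsumEFin// -EFinM fimfunE.
  by rewrite mulr_fsuml.
- move=> r; apply/measurable_EFinP/measurable_funM; last exact: measurable_funTS.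
  exact/measurable_funM.
- move=> r x _; rewrite EFinM mule_ge0 ?lee_fin// -lee_fin.
  by rewrite nnfun_muleindic_ge0.
Qed.

Lemma integral_density D (f : T -> R) :
  measurable D -> measurable_fun D f ->
  \int[nu]_(y in D) (f y)%:E = \int[m]_(y in D) (f y * h y)%:E.
Proof.
move=> mD mf; rewrite [LHS]integralE [RHS]integralE.
have mfE : measurable_fun D (EFin \o f) by exact/measurable_EFinP.
rewrite !ge0_integral_density//; last 2 first.
- exact: measurable_funeneg.
- exact: measurable_funepos.
congr (_ - _); apply: eq_integral => x _.
- rewrite !funeposE.
  by rewrite -!EFin_max -EFinM maxr_pMl// mul0r.
- rewrite !funenegE -!EFinN -!EFin_max -EFinM maxr_pMl// mul0r.
  by rewrite mulNr.
Qed.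

Lemma integrable_density D (f : T -> R) : measurable D ->
  measurable_fun D f ->
  nu.-integrable D (EFin \o f) <-> m.-integrable D (fun y => (f y * h y)%:E).
Proof.
move=> mD mf.
have mfE : measurable_fun D (EFin \o f) by exact/measurable_EFinP.
have mfhE : measurable_fun D (fun y => (f y * h y)%:E).
  by apply/measurable_EFinP/measurable_funM => //; exact: measurable_funTS.
have E : \int[nu]_(y in D) `|(f y)%:E| = \int[m]_(y in D) `|(f y * h y)%:E|.
  rewrite ge0_integral_density//; last exact: measurableT_comp.
  by apply: eq_integral => x _; rewrite -EFinM abse_EFin normrM (ger0_norm (h0 x)).
by split=> /integrableP[_ fi]; apply/integrableP; split=> //;
  rewrite ?E// -?E.
Qed.

End density.

Lemma Rintegral_support d (T : measurableType d) (R : realType)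
    (m : {measure set T -> \bar R})
    (D E : set T) (f : T -> R) : E `<=` D ->
  (forall x, D x -> ~ E x -> f x = 0) ->
  (\int[m]_(x in D) f x = \int[m]_(x in E) f x)%R.
Proof.
move=> ED f0; rewrite Rintegral_mkcond [RHS]Rintegral_mkcond.
apply: eq_Rintegral => x _; rewrite !patchE.
case: ifPn => [|] xD; case: ifPn => [|] xE //.
- by rewrite f0//; [rewrite inE in xD|rewrite notin_setE in xE].
- by exfalso; rewrite notin_setE in xD; rewrite inE in xE; exact/xD/ED.
Qed.

(** * The Haar measure of the multiplicative group *)

(** The canonical measure structure on a pushforward depends on the proof of
    measurability, which cannot be inferred from the function. *)
Definition image_measure d d' (T1 : measurableType d) (T2 : measurableType d')
    (R : realType) (m : {measure set T1 -> \bar R}) (f : T1 -> T2)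
    (mf : measurable_fun setT f) : {measure set T2 -> \bar R} :=
  measure_function_pushforward__canonical__measure_function_Measure m mf.

Section haar_facts.
Context {R : realType}.
Implicit Types (a b v : R) (m : {measure set (measurableTypeR R) -> \bar R}).

Lemma RposE (x : R) : Rpos x = (0 < x) :> Prop.
Proof. by rewrite /Rpos /= in_itv /= andbT. Qed.

Lemma measurable_Rpos : measurable (@Rpos R : set (measurableTypeR R)).
Proof. exact: measurable_itv. Qed.

(** Transporting both measures to the whole line by ln turns the intervals
    ]a, b[ with a > 0 into all bounded open intervals, a generating system
    closed under intersection that exhausts the line. *)
Lemma measure_Rpos_unique m1 m2 :
  (forall a b, 0 < a -> m1 `]a, b[%classic = m2 `]a, b[%classic) ->
  (forall a b, 0 < a -> (m1 `]a, b[%classic < +oo)%E) ->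
  forall S : set (measurableTypeR R), measurable S -> S `<=` Rpos ->
  m1 S = m2 S.
Proof.
move=> m12 m1fin S mS SR.
have mln : measurable_fun setT (@ln R : measurableTypeR R -> measurableTypeR R).
  exact: measurable_ln.
pose n m := image_measure (mrestr m measurable_Rpos) mln.
have lnitv a b : @ln R @^-1` `]a, b[ `&` Rpos = `]expR a, expR b[%classic.
  apply/seteqP; split=> x /=.
    rewrite RposE !in_itv/= => -[/andP[ax xb] x0].
    by rewrite -[x]lnK// !ltr_expR ax.
  rewrite RposE !in_itv/= => /andP[ax xb].
  have x0 : 0 < x by rewrite (lt_trans _ ax)// expR_gt0.
  by rewrite -[a]expRK -[b]expRK !ltr_ln ?posrE ?expR_gt0// ax.
have nE m a b : n m `]a, b[%classic = m `]expR a, expR b[%classic.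
  by rewrite /n/= /pushforward /mrestr lnitv.
have E (A : set (measurableTypeR R)) : measurable A -> n m1 A = n m2 A.
  move=> mA.
  apply: (@measure_unique _ R (measurableTypeR R) (@RGenOpens.G R)
    (fun k => `]- k%:R, k%:R[%classic) _ _ _ _ (n m1) (n m2)) => //.
  - exact: RGenOpens.measurableE.
  - move=> _ _ [x [y ->]] [z [t ->]].
    exists (Num.max x z), (Num.min y t); apply/seteqP; split=> u /=.
      rewrite !in_itv/= gt_max lt_min => -[/andP[-> ->] /andP[-> ->]].
      by [].
    by rewrite !in_itv/= gt_max lt_min => /andP[/andP[-> ->] /andP[-> ->]].
  - by move=> k; exists (- k%:R), k%:R.
  - apply/seteqP; split=> // x _; exists (Num.trunc `|x|).+1 => //=.
    by rewrite in_itv/= -ltr_norml truncnS_gt.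
  - by move=> _ [x [y ->]]; rewrite !nE m12// expR_gt0.
  - by move=> k; rewrite nE m1fin// expR_gt0.
have mE : measurable (expR @^-1` S : set (measurableTypeR R)).
  by rewrite -[X in measurable X]setTI; exact: measurable_expR.
have SE : @ln R @^-1` (expR @^-1` S) `&` Rpos = S.
  apply/seteqP; split=> x /=.
    by rewrite RposE => -[+ x0]; rewrite lnK.
  move=> Sx; have x0 : 0 < x by rewrite -RposE; exact: SR.
  by rewrite RposE lnK.
by have := E _ mE; rewrite /n/= /pushforward /mrestr SE.
Qed.

Lemma haar_setI_Rpos (S : set (measurableTypeR R)) : haar (S `&` Rpos) = haar S.
Proof.
rewrite /haar integral_mkcondr; apply: eq_integral => x _.
rewrite patchE; case: ifPn => //; rewrite notin_setE RposE => /negP.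
by rewrite /haar_density => /negbTE ->.
Qed.

Lemma haar_itvoo a b : 0 < a -> a < b ->
  haar (`]a, b[ : set (measurableTypeR R)) = (ln b - ln a)%:E.
Proof.
move=> a0 ab; rewrite /haar.
have dl : {in `[a, b], forall x : R, is_derive x 1 (@ln R) (haar_density x)}.
  move=> x; rewrite in_itv/= => /andP[ax _].
  have x0 : 0 < x by rewrite (lt_le_trans a0).
  by rewrite /haar_density x0; exact: is_derive1_ln.
have mh := @measurable_haar_density R.
have ch : {in `[a, b], forall x, {for x, continuous (@haar_density R)}}.
  move=> x; rewrite in_itv/= => /andP[ax _].
  have x0 : 0 < x by rewrite (lt_le_trans a0).
  have : {for x, continuous (fun y : R => y^-1)}.
    by apply: cvgV; [rewrite gt_eqF|exact: cvg_id].
  rewrite /prop_for /continuous_at /haar_density x0; apply: cvg_trans.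
  apply: near_eq_cvg; near=> y; rewrite ifT//; near: y.
  exact: lt_nbhsr.
rewrite -(@integral_itv_bndoo _ _ _ _ true false); last first.
  exact/measurable_EFinP/measurable_funTS.
rewrite EFinB; apply: continuous_FTC2 => //.
- by apply: continuous_in_subspaceT => x; rewrite inE/= => xab; exact: ch.
- split.
  + by move=> x xab; have [] := dl x (subset_itv_oo_cc xab).
  + apply/cvg_at_right_filter/is_derive1_continuous/dl.
    by rewrite in_itv/= lexx ltW.
  + apply/cvg_at_left_filter/is_derive1_continuous/dl.
    by rewrite in_itv/= lexx ltW.
- by move=> x xab; rewrite derive1E; have [] := dl x (subset_itv_oo_cc xab).
Unshelve. all: by end_near. Qed.

Lemma haar_itvoo_lty a b : 0 < a ->
  (haar (`]a, b[ : set (measurableTypeR R)) < +oo)%E.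
Proof.
move=> a0; have [ab|ba] := ltP a b; first by rewrite haar_itvoo// ltry.
by rewrite set_itv_ge ?measure0// bnd_simp -leNgt.
Qed.

Lemma haar_itvcc_lty a b : 0 < a ->
  (haar (`[a, b] : set (measurableTypeR R)) < +oo)%E.
Proof.
move=> a0; apply: le_lt_trans (@haar_itvoo_lty (a / 2) (b + 1) _).
  apply: le_measure; rewrite ?inE//; try exact: measurable_itv.
  move=> x /=; rewrite !in_itv/= => /andP[ax xb]; apply/andP; split.
    by rewrite (lt_le_trans _ ax)// ltr_pdivrMr// ltr_pMr// ltr1n.
  by rewrite (le_lt_trans xb)// ltrDl.
by rewrite divr_gt0.
Qed.

Lemma haar_sigma_finite : sigma_finite setT (@haar R).
Proof.
exists (fun n => `]-oo, 0] `|` `](n.+1%:R)^-1, n.+1%:R[).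
  apply/esym/seteqP; split=> // x _; have [x0|x0] := leP x 0.
    by exists 0%N => //=; left; rewrite in_itv/=.
  have xV0 : 0 < x^-1 by rewrite invr_gt0.
  exists (Num.trunc (x + x^-1)) => //=; right; rewrite in_itv/=.
  have h := truncnS_gt (x + x^-1).
  apply/andP; split; last by rewrite (le_lt_trans _ h)// lerDl ltW.
  by rewrite -[ltRHS]invrK ltf_pV2 ?posrE// (le_lt_trans _ h)// lerDr ltW.
move=> n; split.
  by apply: measurableU; exact: measurable_itv.
rewrite -haar_setI_Rpos setIUl (_ : `]-oo, 0] `&` Rpos = set0) ?set0U.
  by rewrite haar_setI_Rpos haar_itvoo_lty// invr_gt0.
apply/seteqP; split=> // x /=; rewrite RposE in_itv/= => -[].
by rewrite leNgt => /negP.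
Qed.

HB.instance Definition _ :=
  @Measure_isSigmaFinite.Build _ _ _ (@haar R) haar_sigma_finite.

(** Both sides are measures of S that give an interval ]a, b[ with a > 0 the mass
    ln (b / a). *)
Lemma haar_scale v (S : set (measurableTypeR R)) : 0 < v -> measurable S ->
  haar ((fun x => v * x) @^-1` S) = haar S.
Proof.
move=> v0 mS.
have mv : measurable_fun setT
    ((fun x : R => v * x) : measurableTypeR R -> measurableTypeR R).
  by apply: measurable_funM => //; exact: measurable_cst.
rewrite -(haar_setI_Rpos S) -haar_setI_Rpos.
rewrite (_ : _ `&` _ = (fun x => v * x) @^-1` (S `&` Rpos)); last first.
  by apply/seteqP; split=> x /=; rewrite !RposE pmulr_rgt0.
have : measurable (S `&` Rpos) by apply: measurableI => //; exact: measurable_Rpos.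
have : S `&` Rpos `<=` Rpos by apply: subIsetr.
move: (S `&` Rpos) => {mS}S SR mS.
apply: (@measure_Rpos_unique (image_measure haar mv) haar) => //.
- move=> a b a0; rewrite /= /pushforward.
  have -> : (fun x => v * x) @^-1` `]a, b[ = `](a / v), (b / v)[%classic.
    apply/seteqP; split=> x /=; rewrite !in_itv/= ltr_pdivrMr// ltr_pdivlMr//;
    by rewrite (mulrC x).
  have [ab|ba] := ltP a b; last first.
    by rewrite !set_itv_ge ?measure0// bnd_simp -leNgt// ler_pM2r// invr_gt0.
  have b0 := lt_trans a0 ab.
  rewrite !haar_itvoo ?divr_gt0 ?ltr_pM2r ?invr_gt0//.
  by rewrite !ln_div ?posrE//; congr (_%:E); ring.
- move=> a b a0; rewrite /= /pushforward.
  have -> : (fun x => v * x) @^-1` `]a, b[ = `](a / v), (b / v)[%classic.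
    apply/seteqP; split=> x /=; rewrite !in_itv/= ltr_pdivrMr// ltr_pdivlMr//;
    by rewrite (mulrC x).
  by rewrite haar_itvoo_lty// divr_gt0.
Qed.

End haar_facts.

(** * Bounded functions of compact support, and a pair of measures for Q delta *)

Section density_measure.
Local Open Scope ereal_scope.
Context d (T : measurableType d) (R : realType).
Variables (m : {measure set T -> \bar R}) (h : T -> R).
Hypotheses (mh : measurable_fun setT h) (h0 : forall x, (0 <= h x)%R).

Definition density_fun (A : set T) : \bar R := \int[m]_(x in A) (h x)%:E.

Let density0 : density_fun set0 = 0. Proof. exact: integral_set0. Qed.

Let density_ge0 A : 0 <= density_fun A.
Proof. by apply: integral_ge0 => x _; rewrite lee_fin. Qed.

Let density_sigma_additive : semi_sigma_additive density_fun.
Proof.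
apply: semi_sigma_additive_nng_induced; first exact/measurable_EFinP.
by move=> x; rewrite lee_fin.
Qed.

Definition density_mixin := isMeasure.Build _ _ _
  density_fun density0 density_ge0 density_sigma_additive.

Definition density_measure : {measure set T -> \bar R} :=
  HB.pack_for {measure set T -> \bar R} density_fun density_mixin.

End density_measure.

Section bounded_support.
Context {R : realType}.
Implicit Types (a b : R) (f g : R -> R)
  (m : {measure set (measurableTypeR R) -> \bar R}).

(** The support condition keeps away from 0, so that such functions are
    integrable for every locally finite measure on ]0, +oo[. *)
Definition bdd_supp f := measurable_fun [set: R] f /\
  exists a b C, [/\ 0 < a, forall x, `|f x| <= C &
                    forall x, ~~ (a <= x <= b) -> f x = 0].

Definition locally_bdd g := measurable_fun [set: R] g /\
  forall a b, 0 < a -> exists C, forall x, a <= x <= b -> `|g x| <= C.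

Lemma bdd_supp_integrable m f (D : set (measurableTypeR R)) :
  locally_finite m -> bdd_supp f -> measurable D ->
  m.-integrable D (EFin \o f).
Proof.
move=> lf [mf [a [b [C [a0 fC f0]]]]] mD.
apply: (@integrableS _ _ _ m setT) => //.
have -> : EFin \o f = (EFin \o f) \_ `[a, b]%classic.
  apply/funext => x; rewrite patchE; case: ifPn => //.
  by rewrite notin_setE/= in_itv/= => /negP xab; rewrite f0.
have mab : measurable (`[a, b] : set (measurableTypeR R)).
  exact: measurable_itv.
apply/(integrable_mkcond _ mab).
apply: measurable_bounded_integrable; first exact: measurable_itv.
- exact: lf.
- exact: measurable_funTS.
- exists C; split; first exact: num_real.
  by move=> M CM x _; exact: (le_trans (fC x) (ltW CM)).
Qed.

Lemma bdd_suppM f g : bdd_supp f -> locally_bdd g ->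
  bdd_supp (fun x => f x * g x).
Proof.
move=> [mf [a [b [C [a0 fC f0]]]]] [mg gC]; split.
  exact: measurable_funM.
have [C' gC'] := gC a b a0; exists a, b, (C * `|C'|); split=> // x.
  have C0 : 0 <= C by rewrite (le_trans _ (fC x)).
  have [xab|xab] := boolP (a <= x <= b); last by rewrite f0// mul0r normr0 mulr_ge0.
  by rewrite normrM ler_pM// (le_trans (gC' _ xab))// ler_norm.
by move=> xab; rewrite f0// mul0r.
Qed.

Lemma bdd_supp_lin f g (c : R) : bdd_supp f -> bdd_supp g ->
  bdd_supp (fun x => f x + c * g x).
Proof.
move=> [mf [a [b [C [a0 fC f0]]]]] [mg [a' [b' [C' [a'0 gC' g0]]]]]; split.
  apply: measurable_funD => //.
  by apply: measurable_funM => //; exact: measurable_cst.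
exists (Num.min a a'), (Num.max b b'), (C + `|c| * C'); split.
- by rewrite lt_min a0.
- move=> x; rewrite (le_trans (ler_normD _ _))// lerD// normrM.
  by rewrite ler_wpM2l.
- move=> x; rewrite ge_min le_max => xab; rewrite f0 ?g0 ?mulr0 ?addr0//.
  + by apply: contra xab => /andP[-> ->]; rewrite !orbT.
  + by apply: contra xab => /andP[-> ->].
Qed.

Lemma bdd_suppB f g : bdd_supp f -> bdd_supp g -> bdd_supp (fun x => f x - g x).
Proof.
by move=> bf bg; have := bdd_supp_lin (- 1) bf bg; under eq_fun do rewrite mulN1r.
Qed.

Lemma continuous_bounded_itv f a b : continuous f ->
  exists C, forall x, a <= x <= b -> `|f x| <= C.
Proof.
move=> cf; have [ab|ba] := leP a b; last first.
  by exists 0 => x /andP[ax xb]; move: ba; rewrite ltNge (le_trans ax).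
have [|c _ fc] := @EVT_max _ (fun x => `|f x|) a b ab.
  apply: continuous_subspaceT => x.
  by apply: continuous_comp; [exact: cf|exact: norm_continuous].
by exists `|f c| => x xab; apply: fc; rewrite in_itv.
Qed.

Lemma locally_bdd_absln f : continuous f -> locally_bdd (fun x => f `|ln x|).
Proof.
move=> cf; split.
  apply: (measurableT_comp (continuous_measurable_fun cf)).
  exact: (measurableT_comp (@normr_measurable R setT)).
move=> a b a0; have [C fC] := @continuous_bounded_itv f 0 (`|ln a| + `|ln b|) cf.
exists C => x /andP[ax xb]; apply: fC; rewrite normr_ge0/=.
have x0 : 0 < x by rewrite (lt_le_trans a0).
have b0 : 0 < b by rewrite (lt_le_trans x0).
rewrite ler_norml; apply/andP; split.
  rewrite lerNl (@le_trans _ _ (- ln a))// ?lerN2 ?ler_ln//.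
  by rewrite (le_trans (ler_norm _))// normrN lerDl.
by rewrite (@le_trans _ _ (ln b)) ?ler_ln// (le_trans (ler_norm _))// lerDr.
Qed.

Lemma haar_locally_finite : locally_finite (@haar R).
Proof. by move=> a b a0; exact: haar_itvcc_lty. Qed.

End bounded_support.

Section reference_pair.
Context {R : realType}.
Implicit Types (f : R -> R).

Definition Qdelta (x : R) : R := lQdelta `|ln x|.

Lemma locally_bdd_Qdelta : locally_bdd Qdelta.
Proof. exact/locally_bdd_absln/continuous_lQdelta. Qed.

Let Qdelta_pos (x : R) := Num.max (Qdelta x) 0.
Let Qdelta_neg (x : R) := Num.max (- Qdelta x) 0.

Let mpos : measurable_fun setT (Qdelta_pos : measurableTypeR R -> R).
Proof.
by apply: measurable_maxr => //; case: locally_bdd_Qdelta.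
Qed.

Let mneg : measurable_fun setT (Qdelta_neg : measurableTypeR R -> R).
Proof.
apply: measurable_maxr => //; apply: measurableT_comp => //.
by case: locally_bdd_Qdelta.
Qed.

Let pos0 x : 0 <= Qdelta_pos x. Proof. by rewrite le_max lexx orbT. Qed.
Let neg0 x : 0 <= Qdelta_neg x. Proof. by rewrite le_max lexx orbT. Qed.

Let bpos : locally_bdd Qdelta_pos.
Proof.
split=> // a b a0; have [_ /(_ a b a0)[C QC]] := locally_bdd_Qdelta.
exists C => x xab; rewrite (ger0_norm (pos0 x)).
have := QC x xab; rewrite ge_max => QxC; rewrite (le_trans (ler_norm _) QxC)/=.
by rewrite (le_trans _ QxC).
Qed.

Let bneg : locally_bdd Qdelta_neg.
Proof.
split=> // a b a0; have [_ /(_ a b a0)[C QC]] := locally_bdd_Qdelta.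
exists C => x xab; rewrite (ger0_norm (neg0 x)).
have := QC x xab; rewrite ge_max -normrN => QxC; rewrite (le_trans (ler_norm _) QxC)/=.
by rewrite (le_trans _ QxC).
Qed.

Definition muQ : {measure set (measurableTypeR R) -> \bar R} :=
  density_measure haar mpos pos0.

Let nuQ_ac : {measure set (measurableTypeR R) -> \bar R} :=
  density_measure haar mneg neg0.

Let dirac1 : {measure set (measurableTypeR R) -> \bar R} :=
  @dirac _ (measurableTypeR R) (1 : R) R.

Let dirac2 : {measure set (measurableTypeR R) -> \bar R} :=
  measure_add dirac1 dirac1.

Definition nuQ : {measure set (measurableTypeR R) -> \bar R} :=
  measure_add dirac2 nuQ_ac.

Let density_locally_finite (h : R -> R)
    (mh : measurable_fun setT (h : measurableTypeR R -> R)) h0 :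
  locally_bdd h -> locally_finite (density_measure haar mh h0).
Proof.
move=> [_ bh] a b a0; have [C hC] := bh a b a0.
rewrite /= /density_fun.
have mab : measurable (`[a, b] : set (measurableTypeR R)).
  exact: measurable_itv.
apply: le_lt_trans (_ : (\int[haar]_(x in `[a, b]) (cst `|C|%:E) x < +oo)%E).
  apply: (ge0_le_integral haar mab) => //=.
  - by move=> x _; rewrite lee_fin.
  - exact/measurable_EFinP/measurable_funTS.
  - move=> x; rewrite in_itv/= => xab; rewrite lee_fin.
    by rewrite (le_trans (ler_norm _))// (le_trans (hC x xab))// ler_norm.
rewrite integral_cst//.
by rewrite lte_mul_pinfty// haar_itvcc_lty.
Qed.

Lemma muQ_locally_finite : locally_finite muQ.
Proof. exact: density_locally_finite. Qed.

Let nuQ_ac_lf : locally_finite nuQ_ac.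
Proof. exact: density_locally_finite. Qed.

Let dirac1_lf : locally_finite dirac1.
Proof. by move=> a b a0; rewrite /= diracE ltry. Qed.

Let dirac2_lf : locally_finite dirac2.
Proof.
move=> a b a0; rewrite -[X in (X < _)%E]/(measure_add dirac1 dirac1 _).
by rewrite measure_addE lte_add_pinfty//; exact: dirac1_lf.
Qed.

Lemma nuQ_locally_finite : locally_finite nuQ.
Proof.
move=> a b a0; rewrite -[X in (X < _)%E]/(measure_add dirac2 nuQ_ac _).
rewrite measure_addE lte_add_pinfty//.
  exact: dirac2_lf.
exact: nuQ_ac_lf.
Qed.

Lemma Rintegral_measure_add (m1 m2 : {measure set (measurableTypeR R) -> \bar R})
    (D : set (measurableTypeR R)) f :
  locally_finite m1 -> locally_finite m2 -> measurable D -> bdd_supp f ->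
  (\int[measure_add m1 m2]_(x in D) f x =
   \int[m1]_(x in D) f x + \int[m2]_(x in D) f x)%R.
Proof.
move=> lf1 lf2 mD bf; rewrite /Rintegral integral_measure_add//; last 2 first.
- exact: bdd_supp_integrable.
- exact: bdd_supp_integrable.
by rewrite fineD//; apply: integrable_fin_num => //; exact: bdd_supp_integrable.
Qed.

(** The term -2 f(1) comes from the mass 2 of nu at 1. *)
Lemma reference_pairing f : bdd_supp f ->
  (\int[muQ]_(x in Rpos) f x - \int[nuQ]_(x in Rpos) f x =
   - 2 * f 1 + \int[haar]_(x in Rpos) (f x * Qdelta x))%R.
Proof.
move=> bf; have [mf _] := bf; have mR := @measurable_Rpos R.
have -> : (\int[nuQ]_(x in Rpos) f x =
    \int[dirac2]_(x in Rpos) f x + \int[nuQ_ac]_(x in Rpos) f x)%R.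
  exact: Rintegral_measure_add dirac2_lf nuQ_ac_lf mR bf.
have -> : (\int[dirac2]_(x in Rpos) f x =
    \int[dirac1]_(x in Rpos) f x + \int[dirac1]_(x in Rpos) f x)%R.
  exact: Rintegral_measure_add dirac1_lf dirac1_lf mR bf.
have -> : (\int[dirac1]_(x in Rpos) f x)%R = f 1.
  rewrite /Rintegral integral_dirac//; last exact/measurable_EFinP/measurable_funTS.
  by rewrite diracE mem_set ?mul1e// RposE.
have dE (h : R -> R) (mh : measurable_fun setT (h : measurableTypeR R -> R)) h0 :
    (\int[density_measure haar mh h0]_(x in Rpos) f x =
     \int[haar]_(x in Rpos) (f x * h x))%R.
  rewrite /Rintegral (@integral_density _ _ _ haar _ h)//.
  exact: measurable_funTS.
rewrite !dE.
have -> : (\int[haar]_(x in Rpos) (f x * Qdelta x) =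
    \int[haar]_(x in Rpos) (f x * Qdelta_pos x - f x * Qdelta_neg x))%R.
  apply: eq_Rintegral => x _; rewrite -mulrBr; congr (_ * _).
  rewrite /Qdelta_pos /Qdelta_neg; case: (ltP (Qdelta x) 0) => [q0|q0].
    by rewrite sub0r; case: (ltP (- Qdelta x) 0); rewrite ?opprK// oppr_lt0; lra.
  by case: (ltP (- Qdelta x) 0); rewrite ?subr0// oppr_ge0; lra.
rewrite RintegralB//.
- by ring.
- by apply: bdd_supp_integrable => //; [exact: haar_locally_finite|exact: bdd_suppM].
- by apply: bdd_supp_integrable => //; [exact: haar_locally_finite|exact: bdd_suppM].
Qed.

End reference_pair.

(** * The distribution Q delta *)

Section Qdelta_distribution.
Context {R : realType}.
Implicit Types (phi : R -> R) (a b e x : R).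

Lemma is_derive_test phi n x : test_function phi ->
  is_derive x 1 (phi^`(n)%classic) (phi^`(n.+1)%classic x).
Proof.
by move=> [dphi _]; rewrite derive1nS derive1E; exact: DeriveDef.
Qed.

Lemma test_function_out phi : test_function phi ->
  exists a b, [/\ 0 < a, a < 1, 1 < b &
    forall n x, x <= a \/ b <= x -> phi^`(n)%classic x = 0].
Proof.
move=> [_ [a [b [a0 phi0]]]].
have phiout n x : x < a \/ b < x -> phi^`(n)%classic x = 0.
  elim: n x => [|n IH] x xab.
    apply: phi0; case: xab => [xa|bx]; first by rewrite leNgt xa.
    by rewrite (leNgt x b) bx andbF.
  rewrite derive1nS derive1E (@near_eq_derive _ _ _ _ (cst 0)) ?derive_cst//.
  case: xab => xab.
  - by near=> y; apply: IH; left; near: y; exact: lt_nbhsl.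
  - by near=> y; apply: IH; right; near: y; exact: lt_nbhsr.
exists (Num.min (a / 2) (1 / 2)), (Num.max (b + 1) 2); split.
- by rewrite lt_min !divr_gt0.
- by rewrite gt_min; apply/orP; right; lra.
- by rewrite lt_max; apply/orP; right; lra.
move=> n x xab; apply: phiout; case: xab => [|].
  by rewrite le_min => /andP[xa _]; left; lra.
by rewrite ge_max => /andP[xb _]; right; lra.
Unshelve. all: by end_near. Qed.

Lemma test_function_continuous phi n : test_function phi ->
  continuous (phi^`(n)%classic).
Proof. by move=> tphi x; exact: is_derive1_continuous (is_derive_test n x tphi). Qed.

Lemma bdd_supp_test phi : test_function phi -> bdd_supp phi.
Proof.
move=> tphi; have [_ [a [b [a0 phi0]]]] := tphi.
have cphi := test_function_continuous (n := 0%N) tphi.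
split; first exact: continuous_measurable_fun.
have [C phiC] := @continuous_bounded_itv _ phi a b cphi.
exists a, b, `|C|; split=> // x.
have [xab|xab] := boolP (a <= x <= b); last by rewrite phi0// normr0.
by rewrite (le_trans (phiC x xab))// ler_norm.
Qed.

Lemma QopE phi x : test_function phi ->
  Qop phi x = - (x * (phi^`(1)%classic x + x * phi^`(2)%classic x)) + 4^-1 * phi x.
Proof.
move=> tphi; rewrite /Qop; congr (- _ + _).
rewrite [LHS]/theta derive1E; congr (x * _).
have := is_derive1M (is_derive_id x (1 : R)) (is_derive_test 1 x tphi).
by rewrite mul1r => -[_ <-].
Qed.

Let W phi e x : R :=
  phi x * (e * ldelta1 (e * ln x)) - ldelta (e * ln x) * (x * phi^`(1)%classic x).

(** The right-hand side is the boundary term of two integrations by parts in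
    the variable ln x: with e = 1 or -1 and g (x) = G(e ln x), the derivative of
    phi (x g') - g (x phi') is phi (x g')' - g (x phi')'. *)
Lemma green_identity phi e a b : test_function phi -> e ^+ 2 = 1 ->
  0 < a -> a < b ->
  (\int[lebesgue_measure]_(x in `[a, b])
     ((ldelta (e * ln x) * Qop phi x - phi x * lQdelta (e * ln x)) / x) =
   W phi e b - W phi e a)%R.
Proof.
move=> tphi e2 a0 ab; apply: FTC2_is_derive => // x; rewrite in_itv/= => /andP[ax _].
all: have {ax} x0 : 0 < x by rewrite (lt_le_trans a0).
all: have dln := is_derive1_ln x0.
all: have deln := is_derive1_mull e dln.
all: have dcomp (f : R -> R) (u : R) : is_derive (e * ln x) 1 f u ->
    is_derive x 1 (fun y => f (e * ln y)) (u * (e / x))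
  by move=> df; exact: (@is_derive1_compE R f (fun y => e * ln y)).
all: have dG := dcomp _ _ (is_derive_ldelta (e * ln x)).
- rewrite [X in {for x, continuous X}](_ : _ = (fun x =>
    (ldelta (e * ln x) *
      (- (x * (phi^`(1)%classic x + x * phi^`(2)%classic x)) + 4^-1 * phi x) -
      phi x * lQdelta (e * ln x)) / x)); last first.
    by apply/funext => y; rewrite QopE.
  have cid : {for x, continuous (fun y : R => y)} by exact: cvg_id.
  have c n : {for x, continuous (phi^`(n)%classic)}.
    exact: test_function_continuous.
  have cG := is_derive1_continuous dG.
  have cQ : {for x, continuous (fun y => lQdelta (e * ln y))}.
    apply: (@continuous_comp _ _ _ (fun y => e * ln y) lQdelta).
      exact: is_derive1_continuous deln.
    exact: continuous_lQdelta.
  apply: cvgM; last by apply: cvgV; [rewrite gt_eqF|exact: cid].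
  apply: cvgB; last by apply: cvgM; [exact: (c 0%N)|exact: cQ].
  apply: cvgM; first exact: cG.
  apply: cvgD; last by apply: cvgM; [exact: cvg_cst|exact: (c 0%N)].
  apply: cvgN; apply: cvgM; first exact: cid.
  apply: cvgD; first exact: c.
  by apply: cvgM; [exact: cid|exact: c].
- have dG1 := dcomp _ _ (is_derive_ldelta1 (e * ln x)).
  have d1 := is_derive_test 1 x tphi.
  have d0 := is_derive_test 0 x tphi.
  have dW := is_deriveB (is_derive1M d0 (is_derive1_mull e dG1))
    (is_derive1M dG (is_derive1M (is_derive_id x (1:R)) d1)).
  apply: (is_derive_eq dW); rewrite QopE// /lQdelta.
  rewrite -[phi^`(0)%classic]/phi.
  rewrite (_ : e * (ldelta2 (e * ln x) * (e * x^-1)) =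
    e ^+ 2 * ldelta2 (e * ln x) / x); last by ring.
  rewrite e2 /=.
  move: (ldelta _) (ldelta1 _) (ldelta2 _) (phi x) (phi^`(1)%classic x)
    (phi^`(2)%classic x) => u v w p q r.
  by field; rewrite gt_eqF.
Qed.

(** Green's identity on [a, 1] with e = -1 and on [1, b] with e = 1, where
    ]a, b[ contains the support of phi.  The boundary terms at a and b vanish;
    at 1 those in phi'(1) cancel and those in phi(1) add up to -2 G'(0) phi(1). *)
Lemma is_Qdelta_reference : is_Qdelta (@muQ R) nuQ.
Proof.
split; [exact: muQ_locally_finite|exact: nuQ_locally_finite|].
move=> phi tphi; have bphi := bdd_supp_test tphi.
rewrite reference_pairing//.
have [a [b [a0 a1 b1 out]]] := test_function_out tphi.
have out0 x : x <= a \/ b <= x -> phi x = 0 := out 0%N x.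
have QE : Qop phi = fun x =>
    - (x * (phi^`(1)%classic x + x * phi^`(2)%classic x)) + 4^-1 * phi x.
  by apply/funext => x; rewrite QopE.
have outQ x : x <= a \/ b <= x -> Qop phi x = 0.
  by move=> xab; rewrite QE !out// out0// mulr0 addr0 !mulr0 oppr0 addr0.
have c n : continuous (phi^`(n)%classic) := test_function_continuous (n := n) tphi.
have cQ : continuous (Qop phi).
  rewrite QE => x.
  have cid : {for x, continuous (fun y : R => y)} by exact: cvg_id.
  apply: cvgD; last by apply: cvgM; [exact: cvg_cst|exact: (c 0%N)].
  apply: cvgN; apply: cvgM; first exact: cid.
  apply: cvgD; first exact: c.
  by apply: cvgM; [exact: cid|exact: c].
have bQ : bdd_supp (Qop phi).
  split; first exact: continuous_measurable_fun.
  have [C QC] := @continuous_bounded_itv _ (Qop phi) a b cQ.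
  exists a, b, `|C|; split=> // x; last first.
    by move=> xab; apply: outQ; case: (leP x a) => xa; [left|right];
      case: (leP b x) => xb//; move: xab; rewrite !ltW.
  have [xab|xab] := boolP (a <= x <= b).
    by rewrite (le_trans (QC x xab))// ler_norm.
  rewrite outQ ?normr0//; case: (leP x a) => xa; [left|right];
    by case: (leP b x) => xb//; move: xab; rewrite !ltW.
have cl : continuous (@ldelta R).
  by move=> x; exact: is_derive1_continuous (is_derive_ldelta x).
have bg : bdd_supp (fun x => Qop phi x * ldelta `|ln x|).
  by apply: bdd_suppM => //; exact: locally_bdd_absln.
have bk : bdd_supp (fun x => phi x * Qdelta x).
  by apply: bdd_suppM => //; exact: locally_bdd_Qdelta.
have -> : (\int[haar]_(r in Rpos) (delta r * Qop phi r) =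
    \int[haar]_(x in Rpos) (Qop phi x * ldelta `|ln x|))%R.
  apply: eq_Rintegral => x; rewrite inE RposE => x0.
  by rewrite deltaE// mulrC.
apply/eqP; rewrite eq_sym -subr_eq; apply/eqP.
have mR := @measurable_Rpos R.
rewrite -RintegralB//; last 2 first.
- by apply: bdd_supp_integrable => //; exact: haar_locally_finite.
- by apply: bdd_supp_integrable => //; exact: haar_locally_finite.
pose F x := Qop phi x * ldelta `|ln x| - phi x * Qdelta x.
have bF : bdd_supp F by exact: bdd_suppB.
rewrite -[LHS]/(\int[haar]_(x in Rpos) F x)%R.
have -> : (\int[haar]_(x in Rpos) F x = \int[haar]_(x in `[a, b]) F x)%R.
  apply: Rintegral_support.
    by move=> x /=; rewrite RposE in_itv/= => /andP[ax _]; rewrite (lt_le_trans a0).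
  move=> x _ /=; rewrite in_itv/= => /negP xab.
  have xab' : x <= a \/ b <= x.
    by case: (leP x a) => xa; [left|right];
      case: (leP b x) => xb//; move: xab; rewrite !ltW.
  by rewrite /F outQ// out0// !mul0r subrr.
have mab : measurable (`[a, b] : set (measurableTypeR R)).
  exact: measurable_itv.
have iF : lebesgue_measure.-integrable `[a, b]
    (EFin \o (fun x => F x * haar_density x)).
  apply/(@integrable_density _ _ _ lebesgue_measure haar (@haar_density R)) => //.
  - exact: measurable_haar_density.
  - by move=> x; exact: haar_density_ge0.
  - by apply: measurable_funTS; case: bF.
  - by apply: bdd_supp_integrable => //; exact: haar_locally_finite.
have -> : (\int[haar]_(x in `[a, b]) F x =
    \int[lebesgue_measure]_(x in `[a, b]) (F x * haar_density x))%R.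
  rewrite /Rintegral (@integral_density _ _ _ lebesgue_measure haar (@haar_density R))//.
  - exact: measurable_haar_density.
  - by move=> x; exact: haar_density_ge0.
  - by apply: measurable_funTS; case: bF.
have := @Rintegral_itvB _ _ (BLeft a) (BRight b) 1 iF.
rewrite !bnd_simp => /(_ (ltW a1) (ltW b1)).
move=> /eqP; rewrite subr_eq => /eqP ->.
rewrite Rintegral_itv_obnd_cbnd; last first.
  apply: (@integrableS _ _ _ lebesgue_measure `[a, b]) => //.
  by move=> x /=; rewrite !in_itv/= => /andP[x1 ->]; rewrite (ltW (lt_trans a1 x1)).
have e1 : (1 : R) ^+ 2 = 1 by rewrite expr1n.
have eN1 : (-1 : R) ^+ 2 = 1 by rewrite sqrrN expr1n.
transitivity ((W phi 1 b - W phi 1 1) + (W phi (-1) 1 - W phi (-1) a)).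
  rewrite -(green_identity tphi e1 ltr01 b1) -(green_identity tphi eN1 a0 a1).
  congr (_ + _); apply: eq_Rintegral => x; rewrite inE/= in_itv/= => /andP[].
  - move=> x1 _; have x0 : 0 < x by rewrite (lt_le_trans ltr01).
    rewrite /F /Qdelta /haar_density x0 (ger0_norm (ln_ge0 x1)) mul1r.
    by rewrite (mulrC (Qop _ _)).
  - move=> ax x1; have x0 : 0 < x by rewrite (lt_le_trans a0).
    rewrite /F /Qdelta /haar_density x0 (ler0_norm (ln_le0 x1)) mulN1r.
    by rewrite (mulrC (Qop _ _)).
have Wout e x : x <= a \/ b <= x -> W phi e x = 0.
  by move=> xab; rewrite /W out0// out// (mulr0 x) mul0r sub0r mulr0 oppr0.
have W1 e : W phi e 1 = phi 1 * e - ldelta 0 * phi^`(1)%classic 1.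
  by rewrite /W ln1 (mulr0 e) ldelta10 mulr1 mul1r.
rewrite (Wout 1 b) ?(Wout (-1) a) ?W1; try by [left|right].
by move: (ldelta 0) (phi 1) (phi^`(1)%classic 1) => u v w; ring.
Qed.

End Qdelta_distribution.

(** * Test functions determine the pairing *)

Section flat_exponential.
Context {R : realType}.
Implicit Types (x y : R) (k l n : nat).

(** The derivative of exp(-1/y) y^-k is a combination of two functions of the
    same kind, so this family contains all derivatives of exp(-1/y). *)
Definition flat_exp k y : R := if 0 < y then y^-1 ^+ k * expR (- y^-1) else 0.

Lemma flat_exp_neg k y : y <= 0 -> flat_exp k y = 0.
Proof. by move=> y0; rewrite /flat_exp ltNge y0. Qed.

Lemma flat_exp_ge0 k y : 0 <= flat_exp k y.
Proof.
rewrite /flat_exp; case: ifPn => // y0.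
by rewrite mulr_ge0 ?expR_ge0// exprn_ge0// invr_ge0 ltW.
Qed.

(** With t = 1/y, this is t^(k+2) <= (k+2)! exp t. *)
Lemma flat_exp_quad k y : `|flat_exp k y| <= k.+2`!%:R * y ^+ 2.
Proof.
rewrite ger0_norm ?flat_exp_ge0// /flat_exp; case: ifPn => y0; last first.
  by rewrite mulr_ge0// sqr_ge0.
have t0 : 0 < y^-1 by rewrite invr_gt0.
rewrite -[y ^+ 2]invrK -exprVn.
set t := y^-1 in t0 *.
rewrite expRN ler_pdivlMr ?exprn_gt0//.
rewrite mulrAC -exprD addn2 ler_pdivrMr ?expR_gt0//.
have := expR_ge1Dxn k.+1 (ltW t0).
rewrite -ler_pdivrMl ?ltr0n ?fact_gt0// mulrC => /le_trans-/(_ _ (lexx _)).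
by move=> h; rewrite (le_trans _ h)// lerDr.
Qed.

Lemma is_derive0_quad (f : R -> R) (C : R) :
  (forall x, `|f x| <= C * x ^+ 2) -> is_derive (0 : R) 1 f 0.
Proof.
move=> fC; have f0 : f 0 = 0.
  by apply/eqP; rewrite -normr_le0 (le_trans (fC 0))// expr0n mulr0.
have L : (fun h => h^-1 *: ((f \o shift 0) (h *: (1:R)) - f 0)) @ 0^' --> (0 : R).
  apply/cvgrPdist_le => e e0; near=> h.
  have hn0 : h != 0 by near: h; exact: nbhs_dnbhs_neq.
  have he : `|h| < e / (`|C| + 1).
    by near: h; apply: dnbhs0_lt; rewrite divr_gt0// ltr_wpDl.
  rewrite sub0r normrN /= /GRing.scale/= mulr1 addr0 f0 subr0 normrM normfV.
  rewrite ler_pdivrMl ?normr_gt0//.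
  rewrite (le_trans (fC h))// -real_normK ?num_real// expr2 mulrA mulrC.
  rewrite ler_wpM2l//.
  rewrite ltr_pdivlMr ?ltr_wpDl// in he.
  rewrite (le_trans _ (ltW he))// mulrC ler_wpM2l//.
  by rewrite (le_trans (ler_norm _))// lerDl.
apply: DeriveDef; first by apply/cvg_ex; exists 0.
exact: cvg_lim L.
Unshelve. all: by end_near. Qed.

Lemma is_derive_flat_exp k y :
  is_derive y 1 (flat_exp k) (flat_exp k.+2 y - k%:R * flat_exp k.+1 y).
Proof.
have [y0|y0|y0] := ltgtP y 0.
- rewrite !flat_exp_neg ?(ltW y0)// mulr0 subr0.
  apply: (@near_eq_is_derive _ _ _ (cst 0)).
  near=> z; rewrite flat_exp_neg// ltW//; near: z; exact: lt_nbhsl.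
- have dV : is_derive y 1 (fun z : R => z^-1) (- (y ^- 2)).
    have := @is_deriveV R id y 1 1 (lt0r_neq0 y0) (is_derive_id y 1).
    by rewrite /GRing.scale/= mulr1.
  have dX := @is_deriveX R R (fun z : R => z^-1) k y 1 _ dV.
  have dE := @is_derive1_compE R expR (fun z => - z^-1) y _ _
    (is_derive_expR _) (is_deriveN dV).
  have d := is_derive1M dX dE.
  apply: (@near_eq_is_derive _ _ _
      (fun z : R => ((fun z : R => z^-1) ^+ k) z * expR (- z^-1))).
    near=> z; rewrite /flat_exp ifT ?exprfctE//; near: z; exact: lt_nbhsr.
  rewrite /flat_exp y0.
  apply: (is_derive_eq d).
  rewrite exprfctE /GRing.scale/= -!exprVn opprK.
  move: (expR _) => u.
  case: k {dX d} => [|k].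
    by rewrite !exprS !expr0; ring.
  by rewrite !exprS /=; ring.
- rewrite y0 !flat_exp_neg// mulr0 subr0.
  exact: is_derive0_quad (flat_exp_quad k).
Unshelve. all: by end_near. Qed.

End flat_exponential.

Section bump.
Context {R : realType} (s c d : R).
Implicit Types (x : R) (k l n : nat).

Definition bump_term k l x : R := flat_exp k (s * (x - c)) * flat_exp l (s * (d - x)).

(** A class of functions stable under differentiation, which is how a bump is
    seen to be infinitely differentiable. *)
Inductive bump_class : (R -> R) -> Prop :=
| bump_class_term k l : bump_class (bump_term k l)
| bump_class_lin (u v : R) g h : bump_class g -> bump_class h ->
    bump_class (fun x => u * g x + v * h x).

Let is_derive_bump_term k l x : is_derive x 1 (bump_term k l)
  (1 * (s * bump_term k.+2 l x + (- s * k%:R) * bump_term k.+1 l x) +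
   1 * (- s * bump_term k l.+2 x + (s * l%:R) * bump_term k l.+1 x)).
Proof.
have d1 : is_derive x 1 (fun x => s * (x - c)) s.
  rewrite -[X in is_derive _ _ _ X]mulr1; apply: is_derive1_mull.
  rewrite -[X in is_derive _ _ _ X]addr0.
  exact: is_derive1D.
have d2 : is_derive x 1 (fun x => s * (d - x)) (- s).
  rewrite -[X in is_derive _ _ _ X]mulrN1; apply: is_derive1_mull.
  rewrite -[X in is_derive _ _ _ X]add0r.
  exact: is_derive1D.
have e1 := @is_derive1_compE R _ (fun x => s * (x - c)) x _ _
  (is_derive_flat_exp k _) d1.
have e2 := @is_derive1_compE R _ (fun x => s * (d - x)) x _ _
  (is_derive_flat_exp l _) d2.
apply: (is_derive_eq (is_derive1M e1 e2)).
by rewrite /bump_term; ring.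
Qed.

Let bump_class_derive (g : R -> R) : bump_class g ->
  (forall x : R, derivable g x 1) /\ bump_class g^`()%classic.
Proof.
elim=> [k l|u v f h _ [df cf] _ [dh ch]].
  split=> [x|]; first by case: (is_derive_bump_term k l x).
  rewrite (_ : _^`()%classic = (fun x =>
    1 * (s * bump_term k.+2 l x + (- s * k%:R) * bump_term k.+1 l x) +
    1 * (- s * bump_term k l.+2 x + (s * l%:R) * bump_term k l.+1 x))).
    by do 2 apply: bump_class_lin; exact: bump_class_term.
  by apply/funext => x; rewrite derive1E; case: (is_derive_bump_term k l x).
have dfh (x : R) : is_derive x 1 (fun x => u * f x + v * h x)
    (u * f^`()%classic x + v * h^`()%classic x).
  rewrite !derive1E.
  by apply: is_derive1D; apply: is_derive1_mull; exact: DeriveDef.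
split=> [x|]; first by case: (dfh x).
rewrite (_ : _^`()%classic =
  (fun x => u * f^`()%classic x + v * h^`()%classic x)).
  exact: bump_class_lin.
by apply/funext => x; rewrite derive1E; case: (dfh x).
Qed.

(** For s > 0, a function of support [c, d] that tends to the indicator of
    ]c, d[ as s grows, because exp(-1/(s y)) tends to 1 for y > 0. *)
Definition bump : R -> R := bump_term 0 0.

Lemma bump_out x : 0 < s -> ~~ (c < x < d) -> bump x = 0.
Proof.
move=> s0; rewrite negb_and -!leNgt => /orP[xc|dx]; rewrite /bump /bump_term.
  by rewrite flat_exp_neg ?mul0r// pmulr_rle0// subr_le0.
by rewrite mulrC flat_exp_neg ?mul0r// pmulr_rle0// subr_le0.
Qed.

Lemma test_function_bump : 0 < s -> 0 < c -> test_function bump.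
Proof.
move=> s0 c0; split.
  suff cls n : bump_class bump^`(n)%classic.
    by move=> n x; have [+ _] := bump_class_derive (cls n); exact.
  elim: n => [|n IH]; first exact: bump_class_term.
  by rewrite derive1nS; have [] := bump_class_derive IH.
exists c, d; split=> // x xcd; apply: bump_out => //.
by apply: contra xcd => /andP[/ltW -> /ltW ->].
Qed.

Lemma bump_ge0 x : 0 <= bump x.
Proof. by rewrite /bump /bump_term mulr_ge0 ?flat_exp_ge0. Qed.

Lemma bump_le1 x : bump x <= 1.
Proof.
have E y : @flat_exp R 0 y <= 1.
  rewrite /flat_exp; case: ifPn => // y0.
  by rewrite expr0 mul1r expR_le1 oppr_le0 invr_ge0 ltW.
by rewrite /bump /bump_term mulr_ile1 ?flat_exp_ge0.
Qed.

End bump.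

Lemma cvg_bump {R : realType} (c d x : R) : c < x < d ->
  bump n.+1%:R c d x @[n --> \oo] --> (1 : R).
Proof.
have E (y : R) : 0 < y -> flat_exp 0 (n.+1%:R * y) @[n --> \oo] --> (1 : R).
  move=> y0.
  have -> : (fun n => flat_exp 0 (n.+1%:R * y)) =
      (fun n => expR (- (y^-1 * n.+1%:R^-1))).
    apply/funext => n; rewrite /flat_exp pmulr_rgt0// y0 expr0 mul1r.
    by rewrite invfM mulrC.
  have h : (- (y^-1 * n.+1%:R^-1)) @[n --> \oo] --> (0 : R).
    rewrite -[X in _ --> X]oppr0; apply: cvgN.
    rewrite -(mulr0 (y^-1)); apply: cvgM; first exact: cvg_cst.
    exact: cvg_harmonic.
  by rewrite -[X in _ --> X]expR0; exact: (@cvg_comp _ _ _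
    (fun n => - (y^-1 * n.+1%:R^-1)) expR _ _ _ h (@continuous_expR R 0)).
move=> /andP[cx xd]; rewrite /bump /bump_term -[X in _ --> X]mulr1.
by apply: cvgM; apply: E; rewrite subr_gt0.
Qed.

Section uniqueness.
Context {R : realType}.
Implicit Types (mu nu m : {measure set (measurableTypeR R) -> \bar R}).

Lemma cvg_integral_bump m (c d : R) : locally_finite m -> 0 < c ->
  (\int[m]_(x in Rpos) bump n.+1%:R c d x)%R @[n --> \oo] -->
  fine (m `]c, d[%classic).
Proof.
move=> lf c0; have mcd : measurable (`]c, d[ : set (measurableTypeR R)).
  exact: measurable_itv.
have mcdoo : (m `]c, d[%classic < +oo)%E.
  apply: le_lt_trans (lf c d c0); apply: le_measure; rewrite ?inE//;
    try exact: measurable_itv.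
  exact: subset_itv_oo_cc.
have tb n : test_function (bump n.+1%:R c d) by exact: test_function_bump.
have ib n D : measurable D -> m.-integrable D (EFin \o bump n.+1%:R c d).
  by move=> mD; apply: bdd_supp_integrable => //; exact: bdd_supp_test.
have -> : (fun n => \int[m]_(x in Rpos) bump n.+1%:R c d x)%R =
    (fun n => fine (\int[m]_(x in `]c, d[) (bump n.+1%:R c d x)%:E)).
  apply/funext => n; apply: Rintegral_support.
    by move=> x /=; rewrite RposE in_itv/= => /andP[cx _]; rewrite (lt_trans c0).
  by move=> x _ /=; rewrite in_itv/= => /negP xcd; rewrite bump_out.
apply: fine_cvg; rewrite fineK; last by rewrite ge0_fin_numE.
rewrite -[X in _ --> X]mul1e -(integral_cst m mcd 1%E).
have [] := @dominated_convergence _ _ _ m _ mcd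
  (fun n x => (bump n.+1%:R c d x)%:E) (cst 1%E) (cst 1%E) => //.
- by move=> n; exact: measurable_int (ib n _ mcd).
- apply/aeW => x /=; rewrite in_itv/= => xcd.
  by apply: cvg_EFin; [exact: nearW|exact: cvg_bump].
- apply: (measurable_bounded_integrable (f := cst (1 : R)) mcd mcdoo) => //.
  exists 1; split; first exact: num_real.
  by move=> M M1 x _; rewrite /= normr1 ltW.
- apply/aeW => x n _; rewrite /= lee_fin.
  by rewrite ger0_norm ?bump_ge0// bump_le1.
Qed.

(** The measures mu + nu' and mu' + nu have the same integrals against bumps, so
    the same mass on the open intervals that are relatively compact in ]0, +oo[. *)
Lemma Qdelta_unique mu nu mu' nu' (f : R -> R) :
  is_Qdelta mu nu -> is_Qdelta mu' nu' -> bdd_supp f ->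
  (\int[mu]_(x in Rpos) f x - \int[nu]_(x in Rpos) f x =
   \int[mu']_(x in Rpos) f x - \int[nu']_(x in Rpos) f x)%R.
Proof.
move=> [lmu lnu E] [lmu' lnu' E'] bf; have mR := @measurable_Rpos R.
pose m1 : {measure set (measurableTypeR R) -> \bar R} := measure_add mu nu'.
pose m2 : {measure set (measurableTypeR R) -> \bar R} := measure_add mu' nu.
suff m12 S : measurable S -> S `<=` Rpos -> m1 S = m2 S.
  apply/eqP; rewrite subr_eq addrAC eq_sym subr_eq eq_sym; apply/eqP.
  rewrite -!Rintegral_measure_add//.
  by congr fine; exact: (eq_measure_integral m2).
have lf m (c d : R) : locally_finite m -> 0 < c ->
    m `]c, d[%classic \is a fin_num.
  move=> lm c0; rewrite ge0_fin_numE//; apply: le_lt_trans (lm c d c0).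
  apply: le_measure; rewrite ?inE//; try exact: measurable_itv.
  exact: subset_itv_oo_cc.
move=> mS SR; apply: measure_Rpos_unique mS SR => c d c0.
  have cvgB m m' : locally_finite m -> locally_finite m' ->
      (\int[m]_(x in Rpos) bump n.+1%:R c d x -
       \int[m']_(x in Rpos) bump n.+1%:R c d x)%R @[n --> \oo] -->
      fine (m `]c, d[%classic) - fine (m' `]c, d[%classic).
    by move=> lm lm'; apply: cvgB; exact: cvg_integral_bump.
  have L := cvgB _ _ lmu lnu; have L' := cvgB _ _ lmu' lnu'.
  have LE : fine (mu `]c, d[%classic) - fine (nu `]c, d[%classic) =
            fine (mu' `]c, d[%classic) - fine (nu' `]c, d[%classic).
    rewrite -(cvg_lim _ L)// -(cvg_lim _ L')//; congr (lim (_ @ \oo)).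
    by apply/funext => n; rewrite E ?E'//; exact: test_function_bump.
  rewrite -[LHS]/(measure_add mu nu' _) -[RHS]/(measure_add mu' nu _).
  rewrite !measure_addE -[mu _]fineK ?lf// -[nu _]fineK ?lf//.
  rewrite -[mu' _]fineK ?lf// -[nu' _]fineK ?lf// -!EFinD.
  by congr _%:E; lra.
rewrite -[X in (X < _)%E]/(measure_add mu nu' _) measure_addE.
by rewrite ltey_eq fin_numD !lf.
Qed.

End uniqueness.

(** * Scaling and Fubini's theorem for the Haar measure *)

Section haar_tools.
Context {R : realType}.
Implicit Types (f g h : R -> R) (v w x : R).
Local Notation RR := (measurableTypeR R).

Lemma Rintegral_haar_Rpos f : measurable_fun [set: R] f ->
  (\int[haar]_(x in Rpos) f x = \int[haar]_x f x)%R.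
Proof.
move=> mf.
have E (D : set RR) : measurable D ->
    (\int[haar]_(x in D) f x =
     \int[lebesgue_measure]_(x in D) (f x * haar_density x))%R.
  move=> mD; rewrite /Rintegral.
  rewrite (@integral_density _ _ _ lebesgue_measure haar (@haar_density R))//.
  - exact: measurable_haar_density.
  - by move=> x; exact: haar_density_ge0.
  - exact: measurable_funTS.
rewrite !E//; last exact: measurable_Rpos.
apply/esym/Rintegral_support => // x _; rewrite RposE => /negP x0.
by rewrite /haar_density (negbTE x0) mulr0.
Qed.

Lemma ge0_integral_haar_scale v (f : R -> \bar R) : 0 < v ->
  measurable_fun (setT : set RR) f -> (forall x, (0 <= f x)%E) ->
  (\int[haar]_x f (v * x)%R = \int[haar]_x f x)%E.
Proof.
move=> v0 mf f0.
have mv : measurable_fun (setT : set RR) ((fun x : R => v * x) : RR -> RR).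
  by apply: measurable_funM => //; exact: measurable_cst.
have := @ge0_integral_pushforward _ _ _ _ _ _ mv haar _ f measurableT mf
  (fun y _ => f0 y).
rewrite preimage_setT => <-.
apply: (@eq_measure_integral _ _ _ _ haar (image_measure haar mv)) => A mA _.
exact: haar_scale.
Qed.

Lemma integral_haar_scale v f : 0 < v -> measurable_fun [set: R] f ->
  (\int[haar]_x f (v * x)%R = \int[haar]_x f x)%R.
Proof.
move=> v0 mf; rewrite /Rintegral; congr fine.
rewrite [LHS]integralE [RHS]integralE.
have mfE : measurable_fun (setT : set RR) (EFin \o f) by exact/measurable_EFinP.
rewrite -(@ge0_integral_haar_scale v (EFin \o f)^\+%E)//; last first.
  exact: measurable_funepos.
rewrite -(@ge0_integral_haar_scale v (EFin \o f)^\-%E)//; last first.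
  exact: measurable_funeneg.
by congr (_ - _)%E; apply: eq_integral => x _; rewrite ?funeposE ?funenegE.
Qed.

Lemma integrable_haar_scale v f : 0 < v ->
  haar.-integrable (setT : set RR) (EFin \o f) ->
  haar.-integrable (setT : set RR) (EFin \o (fun x => f (v * x))).
Proof.
move=> v0 /integrableP[mf fi]; apply/integrableP; split.
  apply: (measurableT_comp mf).
  by apply: measurable_funM => //; exact: measurable_cst.
apply: le_lt_trans fi.
rewrite -[leRHS](@ge0_integral_haar_scale v)//; exact: measurableT_comp.
Qed.

(** Tonelli's theorem, the function u bounding the integrals of the sections. *)
Lemma integrable_prod (F : R * R -> R) (u : R -> R) :
  measurable_fun (setT : set (RR * RR)) F ->
  (forall x, (\int[haar]_y `|F (x, y)|%:E <= (u x)%:E)%E) ->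
  haar.-integrable (setT : set RR) (EFin \o u) ->
  (haar \x haar)%E.-integrable (setT : set (RR * RR)) (EFin \o F).
Proof.
move=> mF Fu iu; have mFE : measurable_fun (setT : set (RR * RR)) (EFin \o F).
  exact/measurable_EFinP.
have [_ H] := integrable12ltyP haar haar mFE; apply: H.
apply: le_lt_trans (integrable_lty _ iu) => //.
apply: ge0_le_integral => //.
- by move=> x _; apply: integral_ge0 => y _.
- have mA : measurable_fun (setT : set (RR * RR)) (fun z => `|(F z)%:E|%E).
    by apply: measurableT_comp.
  exact: (@measurable_fun_fubini_tonelli_F _ _ RR RR R haar _ mA).
- by case/integrableP : iu.
- by move=> x _; exact: Fu.
Qed.

Lemma measurable_section2 (F : R * R -> R) (u : R -> R) :
  measurable_fun (setT : set (RR * RR)) F ->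
  (forall x, (\int[haar]_y `|F (x, y)|%:E <= (u x)%:E)%E) ->
  haar.-integrable (setT : set RR) (EFin \o u) ->
  measurable_fun [set: R] (fun y => \int[haar]_x F (x, y))%R.
Proof.
move=> mF Fu iu; have iF := integrable_prod mF Fu iu.
apply: (measurableT_comp (f := fine)); first exact: fine_measurable.
exact: (measurable_fubini_G iF).
Qed.

Lemma Rintegral_Fubini (F : R * R -> R) (u : R -> R) :
  measurable_fun (setT : set (RR * RR)) F ->
  (forall x, (\int[haar]_y `|F (x, y)|%:E <= (u x)%:E)%E) ->
  haar.-integrable (setT : set RR) (EFin \o u) ->
  (forall y, haar.-integrable (setT : set RR) (fun x => (F (x, y))%:E)) ->
  (\int[haar]_y (\int[haar]_x F (x, y)) = \int[haar]_x \int[haar]_y F (x, y))%R.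
Proof.
move=> mF Fu iu iy; have iF := integrable_prod mF Fu iu.
have ix x : haar.-integrable (setT : set RR) (fun y => (F (x, y))%:E).
  apply/integrableP; split.
    apply/measurable_EFinP.
    by apply: (measurableT_comp mF); exact: pair1_measurable.
  exact: le_lt_trans (Fu x) (ltry _).
rewrite /Rintegral; congr fine.
transitivity (\int[haar]_y \int[haar]_x (F (x, y))%:E)%E.
  by apply: eq_integral => y _; rewrite fineK// integrable_fin_num.
transitivity (\int[haar]_x \int[haar]_y (F (x, y))%:E)%E.
  exact/esym/(Fubini iF).
by apply: eq_integral => x _; rewrite fineK// integrable_fin_num.
Qed.

End haar_tools.

(** * Correlations and the compressed convolution operator *)

Section square_integrable.
Context {R : realType} (A : R) (hA : 1 < A).
Implicit Types (f g h q : R -> R) (v w x r : R).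
Local Notation RR := (measurableTypeR R).

Definition L2r g := [/\ measurable_fun [set: R] g,
  haar.-integrable (setT : set RR) (fun x => (g x ^+ 2)%:E) &
  forall x, ~ sqrtI A x -> g x = 0].

Let A0 : 0 < A. Proof. exact: lt_trans hA. Qed.
Let sA0 : 0 < Num.sqrt A. Proof. by rewrite sqrtr_gt0. Qed.

Lemma sqrtI_gt0 x : sqrtI A x -> 0 < x.
Proof.
by rewrite /sqrtI/= in_itv/= => /andP[+ _]; apply: lt_le_trans; rewrite invr_gt0.
Qed.

(** The quotients of two points of sqrt I lie in I: this is why both the
    correlations and the kernel only involve the interval [A^-1, A]. *)
Lemma sqrtI_div v w : sqrtI A v -> sqrtI A w -> A^-1 <= w / v <= A.
Proof.
move=> /[dup] /sqrtI_gt0 v0 + /[dup] /sqrtI_gt0 w0.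
rewrite /sqrtI/= !in_itv/= => /andP[v1 v2] /andP[w1 w2].
have sAA : Num.sqrt A * Num.sqrt A = A by rewrite -expr2 sqr_sqrtr// ltW.
have AE : A^-1 = (Num.sqrt A)^-1 * (Num.sqrt A)^-1 by rewrite -invfM sAA.
apply/andP; split.
  rewrite AE; apply: ler_pM => //; rewrite ?invr_ge0 ?sqrtr_ge0//.
  by rewrite lef_pV2 ?posrE.
rewrite -[leRHS]sAA; apply: ler_pM => //; rewrite ?invr_ge0; try exact: ltW.
by rewrite -[leRHS]invrK lef_pV2 ?posrE ?invr_gt0.
Qed.

Lemma measurable_sqrtI : measurable (sqrtI A : set RR).
Proof. exact: measurable_itv. Qed.

Lemma L2rP g : ((g \in Lfun (@haar R) 2%:E) /\ forall x, ~ sqrtI A x -> g x = 0)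
  <-> L2r g.
Proof.
split=> [[gL g0]|[mg ig g0]]; split=> //.
- by move: gL; rewrite inE => /andP[]; rewrite inE.
- exact: Lfun2_integrable_sqr gL.
- rewrite inE; apply/andP; split; rewrite inE//=.
  rewrite /finite_norm unlock.
  case/integrableP : ig => _ ig; apply: poweR_lty; apply: le_lt_trans ig.
  rewrite le_eqVlt; apply/orP; left; apply/eqP; apply: eq_integral => x _ /=.
  by rewrite powR_mulrn// normrX.
Qed.

Lemma integrable_bdd_sqrtI g C : measurable_fun [set: R] g ->
  (forall x, `|g x| <= C) -> (forall x, ~ sqrtI A x -> g x = 0) ->
  haar.-integrable (setT : set RR) (EFin \o g).
Proof.
move=> mg gC g0; apply: bdd_supp_integrable => //; first exact: haar_locally_finite.
split=> //; exists (Num.sqrt A)^-1, (Num.sqrt A), C; split=> //.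
  by rewrite invr_gt0.
by move=> x xA; apply: g0; rewrite /sqrtI/= in_itv/=; exact/negP.
Qed.

Lemma L2r_bdd g C : measurable_fun [set: R] g ->
  (forall x, `|g x| <= C) -> (forall x, ~ sqrtI A x -> g x = 0) -> L2r g.
Proof.
move=> mg gC g0; split=> //.
apply: (@integrable_bdd_sqrtI (fun x => g x ^+ 2) (C ^+ 2)).
- exact: measurable_funX.
- by move=> x; rewrite normrX lerXn2r ?nnegrE// (le_trans _ (gC x)).
- by move=> x xA; rewrite g0// expr0n.
Qed.

Definition ind_sqrtI : R -> R := \1_(sqrtI A).

Lemma measurable_ind_sqrtI : measurable_fun [set: R] ind_sqrtI.
Proof. by apply: measurable_indic; exact: measurable_sqrtI. Qed.

Lemma ind_sqrtIE x : sqrtI A x -> ind_sqrtI x = 1.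
Proof. by move=> xA; rewrite /ind_sqrtI indicE mem_set. Qed.

Lemma ind_sqrtI_out x : ~ sqrtI A x -> ind_sqrtI x = 0.
Proof. by move=> xA; rewrite /ind_sqrtI indicE memNset. Qed.

Lemma ind_sqrtI_le1 x : `|ind_sqrtI x| <= 1.
Proof.
by rewrite /ind_sqrtI indicE; case: (_ \in _); rewrite ?normr1// normr0.
Qed.

Lemma integrable_ind_sqrtI : haar.-integrable (setT : set RR) (EFin \o ind_sqrtI).
Proof.
apply: integrable_bdd_sqrtI measurable_ind_sqrtI ind_sqrtI_le1 _.
exact: ind_sqrtI_out.
Qed.

Lemma L2r_ind : L2r ind_sqrtI.
Proof.
apply: L2r_bdd measurable_ind_sqrtI ind_sqrtI_le1 _.
exact: ind_sqrtI_out.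
Qed.

Lemma L2r_norm_le g x : L2r g -> `|g x| <= ind_sqrtI x + g x ^+ 2.
Proof.
move=> [_ _ g0]; have [xA|xA] := pselect (sqrtI A x).
  rewrite ind_sqrtIE// -(real_normK (num_real (g x))); set t := `|g x|.
  have : 0 <= (t - 1) ^+ 2 by rewrite sqr_ge0.
  have : 0 <= t by rewrite normr_ge0.
  by rewrite sqrrB1; nra.
by rewrite g0// normr0 ind_sqrtI_out// expr0n addr0.
Qed.

Lemma L2r_integrable g : L2r g -> haar.-integrable (setT : set RR) (EFin \o g).
Proof.
move=> /[dup] Lg [mg ig g0].
apply: (le_integrable _ _ _ (integrableD measurableT integrable_ind_sqrtI ig)) => //.
  exact/measurable_EFinP.
move=> x _ /=; rewrite lee_fin.
by rewrite (le_trans (L2r_norm_le x Lg))// ler_norm.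
Qed.

Let norm_mul_le (a b : R) : `|a * b| <= a ^+ 2 + b ^+ 2.
Proof.
rewrite normrM -(real_normK (num_real a)) -(real_normK (num_real b)).
have : 0 <= (`|a| - `|b|) ^+ 2 by rewrite sqr_ge0.
have : 0 <= `|a| * `|b| by rewrite mulr_ge0.
by rewrite sqrrB; nra.
Qed.

Lemma L2r_integrableM g h : L2r g -> L2r h ->
  haar.-integrable (setT : set RR) (fun x => (g x * h x)%:E).
Proof.
move=> [mg ig g0] [mh ih h0].
apply: (le_integrable _ _ _ (integrableD measurableT ig ih)) => //.
  exact/measurable_EFinP/measurable_funM.
move=> x _ /=; rewrite lee_fin.
by rewrite (le_trans (norm_mul_le _ _))// ler_norm.
Qed.

(** The value of xi * xi^* at 1/r is a combination of such integrals of the real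
    and imaginary parts of xi. *)
Definition corr g h r : R := (\int[haar]_(v in Rpos) (g v * h (v * r)))%R.

Let measurable_scaler g r : measurable_fun [set: R] g ->
  measurable_fun [set: R] (fun v => g (v * r)).
Proof.
move=> mg; apply: (measurableT_comp mg).
by apply: measurable_funM => //; exact: measurable_cst.
Qed.

Lemma corrE g h r : L2r g -> L2r h ->
  corr g h r = (\int[haar]_v (g v * h (v * r)))%R.
Proof.
move=> [mg _ _] [mh _ _]; apply: Rintegral_haar_Rpos.
by apply: measurable_funM => //; exact: measurable_scaler.
Qed.

(** For r outside I, v and v r cannot both lie in sqrt I. *)
Lemma corr_term_out g h v r : L2r g -> L2r h -> ~~ (A^-1 <= r <= A) ->
  g v * h (v * r) = 0.
Proof.
move=> [_ _ g0] [_ _ h0] rA.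
have [vA|vA] := pselect (sqrtI A v); last by rewrite g0// mul0r.
have [wA|wA] := pselect (sqrtI A (v * r)); last by rewrite h0// mulr0.
have v0 := sqrtI_gt0 vA.
by move: (sqrtI_div vA wA) rA; rewrite mulrAC divff ?mul1r ?gt_eqF// => ->.
Qed.

Lemma integrable_corr g h r : L2r g -> L2r h ->
  haar.-integrable (setT : set RR) (fun v => (g v * h (v * r))%:E).
Proof.
move=> /[dup] Lg [mg ig g0] /[dup] Lh [mh ih h0].
have mgh : measurable_fun [set: R] (fun v => g v * h (v * r)).
  by apply: measurable_funM => //; exact: measurable_scaler.
have [rA|rA] := boolP (A^-1 <= r <= A); last first.
  rewrite (_ : (fun v => _) = cst 0%E); first exact: integrable0.
  by apply/funext => v; rewrite corr_term_out.
have r0 : 0 < r by case/andP: rA => + _; apply: lt_le_trans; rewrite invr_gt0.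
have ihr : haar.-integrable (setT : set RR) (fun v => (h (v * r) ^+ 2)%:E).
  under eq_fun do rewrite mulrC.
  exact: (@integrable_haar_scale _ r (fun x => h x ^+ 2)).
apply: (le_integrable _ _ _ (integrableD measurableT ig ihr)) => //.
  exact/measurable_EFinP.
move=> x _ /=; rewrite lee_fin.
by rewrite (le_trans (norm_mul_le _ _))// ler_norm.
Qed.

(* The integrand of the correlation, weighted by a bounded function q of r; for
   q = 1 it gives the measurability of the correlation. *)
Let F1 g h q (z : R * R) : R := g z.1 * h (z.1 * z.2) * q z.2.

Let measurable_F1 g h q : L2r g -> L2r h -> measurable_fun [set: R] q ->
  measurable_fun (setT : set (RR * RR)) (F1 g h q).
Proof.
move=> [mg _ _] [mh _ _] mq.
apply: measurable_funM; last exact: (measurableT_comp mq).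
apply: measurable_funM; first exact: (measurableT_comp mg).
apply: (measurableT_comp mh).
by apply: measurable_funM; [exact: measurable_fst|exact: measurable_snd].
Qed.

Let norm1 g : R := (\int[haar]_x `|g x|)%R.

Let norm1E g : L2r g -> (\int[haar]_x (`|g x|)%:E)%E = (norm1 g)%:E.
Proof.
move=> Lg; rewrite /norm1 /Rintegral fineK//.
have := integrable_norm (L2r_integrable Lg).
exact: integrable_fin_num.
Qed.

Let F1_le g h q C : L2r g -> L2r h -> measurable_fun [set: R] q ->
  (forall x, `|q x| <= C) -> forall v,
  (\int[haar]_r (`|F1 g h q (v, r)|)%:E <= (`|g v| * (C * norm1 h))%:E)%E.
Proof.
move=> /[dup] Lg [mg _ g0] /[dup] Lh [mh _ _] mq qC v.
have [vA|vA] := pselect (sqrtI A v); last first.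
  rewrite g0// normr0 mul0r integral0_eq// => r _.
  by rewrite /F1/= g0// !mul0r normr0.
have v0 := sqrtI_gt0 vA.
have C0 : 0 <= C by rewrite (le_trans _ (qC 0)).
have mhv : measurable_fun [set: R] (fun r => `|h (v * r)|).
  apply: measurableT_comp => //; apply: (measurableT_comp mh).
  by apply: measurable_funM => //; exact: measurable_cst.
rewrite mulrA EFinM -norm1E//.
rewrite -(@ge0_integral_haar_scale _ v (fun x => `|h x|%:E))//; last first.
  by apply/measurable_EFinP; exact: measurableT_comp.
rewrite -ge0_integralZl//; last 2 first.
- exact/measurable_EFinP.
- by rewrite lee_fin mulr_ge0.
apply: ge0_le_integral => //.
- apply/measurable_EFinP; apply: measurableT_comp => //.
  exact: (measurableT_comp (measurable_F1 Lg Lh mq) (pair1_measurable v)).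
- by apply/measurable_EFinP; apply: measurable_funM.
- move=> r _; rewrite /F1/= -EFinM lee_fin !normrM -mulrA -[leRHS]mulrA.
  by rewrite ler_wpM2l// mulrC ler_wpM2r.
Qed.

Let iu g (c : R) : L2r g -> haar.-integrable (setT : set RR)
  (EFin \o (fun v => `|g v| * c)).
Proof.
move=> Lg; rewrite (_ : EFin \o _ = fun v => (c%:E * (`|g v|%R)%:E)%E).
  exact/integrableZl/(integrable_norm (L2r_integrable Lg)).
by apply/funext => v; rewrite /= mulrC EFinM.
Qed.

Lemma measurable_corr g h : L2r g -> L2r h -> measurable_fun [set: R] (corr g h).
Proof.
move=> Lg Lh; have m1 : measurable_fun [set: R] (cst (1 : R)) by [].
have q1 : forall x : R, `|cst (1 : R) x| <= 1 by move=> x; rewrite normr1.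
have := measurable_section2 (measurable_F1 Lg Lh m1) (F1_le Lg Lh m1 q1)
  (iu _ Lg).
rewrite (_ : (fun _ => _) = corr g h)//; apply/funext => r.
by rewrite corrE//; apply: eq_Rintegral => v _; rewrite /F1 mulr1.
Qed.

(** Bounded by |x y| <= x^2 + y^2 and the invariance of the Haar measure. *)
Lemma bdd_supp_corr g h : L2r g -> L2r h -> bdd_supp (corr g h).
Proof.
move=> /[dup] Lg [mg ig g0] /[dup] Lh [mh ih h0].
split; first exact: measurable_corr.
pose C : R := (\int[haar]_x (g x ^+ 2) + \int[haar]_x (h x ^+ 2))%R.
have C0 : 0 <= C by rewrite addr_ge0// Rintegral_ge0// => x _; exact: sqr_ge0.
have out r : ~~ (A^-1 <= r <= A) -> corr g h r = 0.
  move=> rA; rewrite corrE// /Rintegral integral0_eq// => v _.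
  by rewrite corr_term_out.
exists A^-1, A, C; split=> //; first by rewrite invr_gt0.
move=> r; have [rA|rA] := boolP (A^-1 <= r <= A); last by rewrite out// normr0.
have r0 : 0 < r by case/andP: rA => + _; apply: lt_le_trans; rewrite invr_gt0.
have mh2 : measurable_fun [set: R] (fun x => h x ^+ 2) by exact: measurable_funX.
have ihr : haar.-integrable (setT : set RR) (fun v => (h (v * r) ^+ 2)%:E).
  under eq_fun do rewrite mulrC.
  exact: (@integrable_haar_scale _ r (fun x => h x ^+ 2)).
rewrite corrE// (le_trans (le_normr_Rintegral _ (integrable_corr r Lg Lh)))//.
have -> : C = (\int[haar]_x (g x ^+ 2 + h (x * r) ^+ 2))%R.
  rewrite RintegralD//; congr (_ + _).
  under [RHS]eq_Rintegral do rewrite mulrC.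
  by rewrite (@integral_haar_scale _ r (fun x => h x ^+ 2)).
apply: le_Rintegral => //.
- exact: (integrable_norm (integrable_corr r Lg Lh)).
- exact: (integrableD measurableT ig ihr).
Qed.

Lemma corr1 g h : corr g h 1 = (\int[haar]_(v in Rpos) (g v * h v))%R.
Proof. by apply: eq_Rintegral => v _; rewrite mulr1. Qed.

(** Q delta truncated to I, by which it may be replaced thanks to [sqrtI_div];
    the truncation is bounded and measurable on the whole line. *)
Definition Qtrunc x : R := if A^-1 <= x <= A then Qdelta x else 0.

Lemma measurable_Qtrunc : measurable_fun [set: R] Qtrunc.
Proof.
have -> : Qtrunc = (fun x => Qdelta x * \1_(`[A^-1, A]) x).
  apply/funext => x; rewrite /Qtrunc indicE; case: ifPn => xA.
    by rewrite mem_set ?mulr1//= in_itv.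
  by rewrite memNset ?mulr0//= in_itv/=; exact/negP.
apply: measurable_funM; first by case: (@locally_bdd_Qdelta R).
by apply: measurable_indic; exact: measurable_itv.
Qed.

Lemma Qtrunc_bdd : exists2 C, 0 <= C & forall x, `|Qtrunc x| <= C.
Proof.
have AV : 0 < A^-1 by rewrite invr_gt0.
have [_ /(_ A^-1 A AV)[C QC]] := @locally_bdd_Qdelta R.
exists `|C| => // x; rewrite /Qtrunc; case: ifPn => xA; last by rewrite normr0.
by rewrite (le_trans (QC x xA))// ler_norm.
Qed.

(** The compression to sqrt I of the convolution by the density of Q delta. *)
Definition conv_op g w : R :=
  if w \in (sqrtI A : set R) then (\int[haar]_(v in Rpos) (g v * Qdelta (w / v)))%R
  else 0.

(* The Haar density stands for the inverse, with which it coincides on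
   ]0, +oo[; it is measurable on the whole line. *)
Let F2 g h (z : R * R) : R := g z.1 * (h z.2 * Qtrunc (z.2 * haar_density z.1)).

Let measurable_kernel : measurable_fun (setT : set (RR * RR))
  (fun z => Qtrunc (z.2 * haar_density z.1)).
Proof.
apply: (measurableT_comp measurable_Qtrunc); apply: measurable_funM.
  exact: measurable_snd.
exact: (measurableT_comp (@measurable_haar_density R)).
Qed.

Let measurable_F2 g h : L2r g -> L2r h ->
  measurable_fun (setT : set (RR * RR)) (F2 g h).
Proof.
move=> [mg _ _] [mh _ _]; apply: measurable_funM.
  exact: (measurableT_comp mg).
by apply: measurable_funM; first exact: (measurableT_comp mh).
Qed.

Let F2_le g h C : L2r g -> L2r h -> 0 <= C -> (forall x, `|Qtrunc x| <= C) ->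
  forall v, (\int[haar]_w (`|F2 g h (v, w)|)%:E <= (`|g v| * (C * norm1 h))%:E)%E.
Proof.
move=> /[dup] Lg [mg _ _] /[dup] Lh [mh _ _] C0 QC v.
rewrite mulrA EFinM -norm1E// -ge0_integralZl//; last 2 first.
- by apply/measurable_EFinP; exact: measurableT_comp.
- by rewrite lee_fin mulr_ge0.
apply: ge0_le_integral => //.
- apply/measurable_EFinP; apply: measurableT_comp => //.
  exact: (measurableT_comp (measurable_F2 Lg Lh) (pair1_measurable v)).
- apply/measurable_EFinP; apply: measurable_funM => //.
  exact: measurableT_comp.
- move=> w _; rewrite /F2/= -EFinM lee_fin !normrM -[leRHS]mulrA.
  by rewrite ler_wpM2l// mulrC ler_wpM2r.
Qed.

Let F2_integrable g h w : L2r g -> L2r h ->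
  haar.-integrable (setT : set RR) (fun v => (F2 g h (v, w))%:E).
Proof.
move=> /[dup] Lg [mg _ _] /[dup] Lh [mh _ _].
have [C C0 QC] := Qtrunc_bdd.
apply: (le_integrable _ _ _ (iu (`|h w| * C) Lg)) => //.
  apply/measurable_EFinP.
  exact: (measurableT_comp (measurable_F2 Lg Lh) (pair2_measurable w)).
move=> v _; rewrite /= /F2/= lee_fin !normrM normr_id.
rewrite ler_wpM2l// (ger0_norm C0) normr_id ler_wpM2l//.
Qed.

Lemma Qtrunc_kernel g v w : L2r g -> sqrtI A w ->
  g v * Qtrunc (w * haar_density v) = g v * Qdelta (w / v).
Proof.
move=> [_ _ g0] wA; have [vA|vA] := pselect (sqrtI A v); last by rewrite g0// !mul0r.
by rewrite /haar_density (sqrtI_gt0 vA) /Qtrunc (sqrtI_div vA wA).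
Qed.

Lemma conv_opE g w : L2r g -> sqrtI A w ->
  conv_op g w = (\int[haar]_v (g v * Qtrunc (w * haar_density v)))%R.
Proof.
move=> /[dup] Lg [mg _ _] wA; rewrite /conv_op mem_set//.
rewrite -Rintegral_haar_Rpos.
  by apply: eq_Rintegral => v _; rewrite Qtrunc_kernel.
apply: measurable_funM => //.
exact: (measurableT_comp measurable_kernel (pair2_measurable w)).
Qed.

Lemma conv_op_out g w : ~ sqrtI A w -> conv_op g w = 0.
Proof. by move=> wA; rewrite /conv_op memNset. Qed.

Lemma integrable_conv_op g w : L2r g ->
  haar.-integrable (setT : set RR)
    (fun v => (g v * Qtrunc (w * haar_density v))%:E).
Proof.
move=> /[dup] Lg [mg _ _].
have [C C0 QC] := Qtrunc_bdd.
apply: (le_integrable _ _ _ (iu C Lg)) => //.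
  apply/measurable_EFinP; apply: measurable_funM => //.
  exact: (measurableT_comp measurable_kernel (pair2_measurable w)).
by move=> v _; rewrite /= lee_fin !normrM normr_id ler_wpM2l// (ger0_norm C0).
Qed.

Let mul_conv_op g h w : L2r g -> L2r h ->
  h w * conv_op g w = (\int[haar]_v F2 g h (v, w))%R.
Proof.
move=> Lg /[dup] Lh [_ _ h0].
have [wA|wA] := pselect (sqrtI A w); last first.
  rewrite h0// mul0r /Rintegral integral0_eq// => v _.
  by rewrite /F2/= h0// mul0r mulr0.
rewrite conv_opE// -RintegralZl//; last exact: integrable_conv_op.
by apply: eq_Rintegral => v _; rewrite /F2/= mulrCA.
Qed.

Lemma measurable_conv_op g : L2r g -> measurable_fun [set: R] (conv_op g).
Proof.
move=> Lg; have [C C0 QC] := Qtrunc_bdd.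
have := measurable_section2 (measurable_F2 Lg L2r_ind)
  (F2_le Lg L2r_ind C0 QC) (iu _ Lg).
rewrite (_ : (fun _ => _) = conv_op g)//; apply/funext => w.
rewrite -mul_conv_op//; last exact: L2r_ind.
have [wA|wA] := pselect (sqrtI A w); first by rewrite ind_sqrtIE// mul1r.
by rewrite conv_op_out// mulr0.
Qed.

Lemma conv_op_le g C w : L2r g -> (forall x, `|Qtrunc x| <= C) ->
  `|conv_op g w| <= C * (\int[haar]_x `|g x|)%R.
Proof.
move=> /[dup] Lg [mg _ _] QC.
have C0 : 0 <= C by rewrite (le_trans _ (QC 0)).
have [wA|wA] := pselect (sqrtI A w); last first.
  by rewrite conv_op_out// normr0 mulr_ge0// Rintegral_ge0.
rewrite conv_opE// (le_trans (le_normr_Rintegral _ (integrable_conv_op _ Lg)))//.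
rewrite -RintegralZl//; last exact: (integrable_norm (L2r_integrable Lg)).
apply: le_Rintegral => //.
- exact: (integrable_norm (integrable_conv_op _ Lg)).
- by under eq_fun do rewrite /= mulrC; exact: iu.
- by move=> v _; rewrite normrM mulrC ler_wpM2r.
Qed.

Lemma L2r_conv_op g : L2r g -> L2r (conv_op g).
Proof.
move=> Lg; have [C C0 QC] := Qtrunc_bdd.
apply: L2r_bdd (measurable_conv_op Lg) (fun w => conv_op_le w Lg QC) _.
exact: conv_op_out.
Qed.

(** Exchange the integrals over r and v, substitute w = v r for fixed v > 0,
    and exchange the integrals over v and w. *)
Lemma integral_corr_Qdelta g h : L2r g -> L2r h ->
  (\int[haar]_(r in Rpos) (corr g h r * Qdelta r) =
   \int[haar]_(w in Rpos) (h w * conv_op g w))%R.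
Proof.
move=> /[dup] Lg [mg _ g0] /[dup] Lh [mh _ h0].
have [C C0 QC] := Qtrunc_bdd.
have [mQ _] := @locally_bdd_Qdelta R.
rewrite !Rintegral_haar_Rpos; last 2 first.
- by apply: measurable_funM => //; exact: measurable_conv_op.
- by apply: measurable_funM => //; exact: measurable_corr.
have F1E v r : F1 g h Qtrunc (v, r) = g v * h (v * r) * Qdelta r.
  rewrite /F1/= /Qtrunc; case: ifPn => // rA.
  by rewrite corr_term_out// !mul0r.
have iF1 r : haar.-integrable (setT : set RR) (fun v => (F1 g h Qtrunc (v, r))%:E).
  under eq_fun do rewrite F1E mulrC EFinM.
  exact/integrableZl/integrable_corr.
transitivity (\int[haar]_r \int[haar]_v F1 g h Qtrunc (v, r))%R.
  apply: eq_Rintegral => r _; rewrite corrE// -RintegralZr//; last first.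
    exact: integrable_corr.
  by apply: eq_Rintegral => v _; rewrite F1E.
rewrite (Rintegral_Fubini (measurable_F1 Lg Lh measurable_Qtrunc)
  (F1_le Lg Lh measurable_Qtrunc QC) (iu _ Lg) iF1).
transitivity (\int[haar]_w \int[haar]_v F2 g h (v, w))%R; last first.
  by apply: eq_Rintegral => w _; rewrite mul_conv_op.
rewrite (Rintegral_Fubini (measurable_F2 Lg Lh) (F2_le Lg Lh C0 QC) (iu _ Lg)
  (fun w => F2_integrable w Lg Lh)).
apply: eq_Rintegral => v _.
have [vA|vA] := pselect (sqrtI A v); last first.
  rewrite /Rintegral !integral0_eq// => r _.
    by rewrite /F2/= g0// !mul0r.
  by rewrite /F1/= g0// !mul0r.
have v0 := sqrtI_gt0 vA.
rewrite -(@integral_haar_scale _ v (fun w => F2 g h (v, w)))//; last first.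
  exact: (measurableT_comp (measurable_F2 Lg Lh) (pair1_measurable v)).
apply: eq_Rintegral => r _; rewrite /F1 /F2/= /haar_density v0 -mulrA.
by rewrite (mulrC v r) mulfK ?gt_eqF.
Qed.

End square_integrable.

(** * Uniformly convergent subsequences *)

Section uniform_subsequence.
Context {R : realType}.
Implicit Types (u : nat -> R -> R) (a b w e : R).

(** The point y may lie outside the interval: continuity is assumed on the line
    at each point x of the interval. *)
Lemma uniformly_continuous_itv (f : R -> R) a b (e : R) : 0 < e ->
  (forall x, a <= x <= b -> {for x, continuous f}) ->
  exists2 d, 0 < d & forall x y, a <= x <= b -> `|x - y| < d -> `|f x - f y| <= e.
Proof.
move=> e0 cf.
have /compact_near_coveringP cov := @segment_compact R a b.
pose P (d : R) (x : R) := forall y, `|x - y| < d -> `|f x - f y| <= e.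
have [|d d0 dP] := cov R (0^'+) P _.
  move=> x; rewrite /= in_itv/= => xab.
  have /cvgrPdist_lt/(_ (e / 2)) := cf x xab.
  rewrite divr_gt0// => /(_ erefl)[r /= r0 rf].
  exists (ball x (r / 2), [set d | d < r / 2]).
    split; first by exists (r / 2) => //=; rewrite divr_gt0.
    by near=> d => /=; near: d; apply: nbhs_right_lt; rewrite divr_gt0.
  move=> [z d] /= [xz dr] y zy.
  have h1 := rf z; have h2 := rf y.
  rewrite /= in h1 h2; rewrite /ball/= in xz.
  have {}h1 : `|f x - f z| < e / 2.
    by apply: h1; rewrite (lt_trans xz)// ltr_pdivrMr// ltr_pMr// ltr1n.
  have {}h2 : `|f x - f y| < e / 2.
    apply: h2; rewrite -(subrK z x) -addrA (le_lt_trans (ler_normD _ _))//.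
    by rewrite [ltRHS]splitr ltrD// (lt_trans zy).
  rewrite -(subrK (f x) (f z)) -addrA (le_trans (ler_normD _ _))//.
  by rewrite [leRHS]splitr lerD// ltW// distrC.
have [d' d'0 d'P] : exists2 d' : R, 0 < d' & `[a, b] `<=` P d'.
  exists (d / 2); first by rewrite divr_gt0.
  apply: dP => /=; last by rewrite divr_gt0.
  by rewrite sub0r normrN gtr0_norm ?divr_gt0// ltr_pdivrMr// ltr_pMr// ltr1n.
exists d' => // x y xab xy; apply: d'P.
Unshelve. all: by end_near. Qed.

(** The theorem of Arzela and Ascoli.  An ultrafilter finer than the filter of
    cofinite sets gives a pointwise limit l without a diagonal extraction.
    Equicontinuity makes the convergence along the ultrafilter uniform, and its
    sets are infinite, so an increasing sequence of indices can be picked in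
    them. *)
Lemma uniform_subsequence u a b (B : R) :
  (forall n w, `|u n w| <= B) ->
  (forall n w, ~~ (a <= w <= b) -> u n w = 0) ->
  (forall e : R, 0 < e -> exists2 d, 0 < d & forall n w w',
     a <= w <= b -> a <= w' <= b -> `|w - w'| < d -> `|u n w - u n w'| <= e) ->
  exists (s : nat -> nat) (l : R -> R),
    {homo s : m n / (m < n)%N} /\
    forall e : R, 0 < e -> exists N, forall k w, (N <= k)%N -> `|u (s k) w - l w| <= e.
Proof.
move=> uB uout equi.
have [U [UU Usub]] := @ultraFilterLemma nat \oo _.
have limU w : exists p : R, (fun n : nat => u n w) @ U --> p.
  have FF : ProperFilter ((fun n => u n w) @ U) by exact: fmap_proper_filter.
  have [|p [_ cp]] := @segment_compact R (- B) B ((fun n => u n w) @ U) FF.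
    by apply: (@filterE _ U) => n; have := uB n w; rewrite ler_norml /= in_itv.
  exists p => V pV.
  have [//|UV] := in_ultra_setVsetC ((fun n => u n w) @^-1` V) UU.
  by have [y []] := cp (~` V) V UV pV.
have [l lU] := choice limU.
have near_l w (e : R) : 0 < e -> U [set n | `|u n w - l w| <= e].
  move=> e0; have /cvgrPdist_le/(_ e e0) := lU w.
  by apply: filterS => n; rewrite /= distrC.
have lout w : ~~ (a <= w <= b) -> l w = 0.
  move=> wab; apply/eqP; rewrite -normr_le0; apply/ler_addgt0Pl => e e0.
  have [n] := filter_ex (near_l w e e0).
  by rewrite /= uout// sub0r normrN addr0.
have unif (e : R) : 0 < e -> U [set n | forall w, `|u n w - l w| <= e].
  move=> e0; have e3 : 0 < e / 3 by rewrite divr_gt0.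
  have [d d0 dP] := equi _ e3.
  (* The points a + j t form a finite net of [a, b] of mesh smaller than d. *)
  pose t := d / 2; have t0 : 0 < t by rewrite divr_gt0.
  pose N := Num.trunc ((b - a) / t).
  pose p (j : 'I_N.+1) := a + j%:R * t.
  have Up : U [set n | forall j, `|u n (p j) - l (p j)| <= e / 3].
    by apply: filter_forall => j; exact: near_l.
  apply: filterS Up => n nP w.
  have [wab|wab] := boolP (a <= w <= b); last first.
    by rewrite uout// lout// subrr normr0 ltW.
  have /andP[aw wb] := wab.
  have wt0 : 0 <= (w - a) / t by rewrite divr_ge0 ?subr_ge0// ltW.
  have /andP[j1 j2] := truncn_itv wt0.
  set j0 := Num.trunc ((w - a) / t) in j1 j2.
  have j0N : (j0 < N.+1)%N.
    rewrite ltnS /j0 /N; apply: le_truncn.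
    by rewrite ler_pM2r ?invr_gt0// lerB.
  pose j : 'I_N.+1 := Ordinal j0N.
  rewrite ler_pdivlMr// in j1; rewrite ltr_pdivrMr// -natr1 mulrDl mul1r in j2.
  have jt0 : 0 <= j0%:R * t by rewrite mulr_ge0// ltW.
  have td : t < d by rewrite /t ltr_pdivrMr// ltr_pMr// ltr1n.
  have pab : a <= p j <= b.
    by rewrite /p/=; apply/andP; split; lra.
  have wp : `|w - p j| < d.
    by rewrite ltr_norml /p/=; apply/andP; split; lra.
  have h1 := dP n w (p j) wab pab wp.
  have h2 := nP j.
  have h3 : `|l (p j) - l w| <= e / 3.
    apply/ler_addgt0Pl => c c0.
    have c2 : 0 < c / 2 by rewrite divr_gt0.
    have [m [m1 m2]] := filter_ex (filterI (near_l w _ c2) (near_l (p j) _ c2)).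
    have h4 := dP m w (p j) wab pab wp.
    move: m1 m2 h4; rewrite /= !ler_norml => /andP[? ?] /andP[? ?] /andP[? ?].
    by apply/andP; split; lra.
  move: h1 h2 h3; rewrite !ler_norml => /andP[? ?] /andP[? ?] /andP[? ?].
  by apply/andP; split; lra.
have pick k m : exists n, (m < n)%N /\ forall w, `|u n w - l w| <= k.+1%:R^-1.
  have Um : U [set n | (m < n)%N] by apply: Usub; exists m.+1.
  have k0 : (0 : R) < k.+1%:R^-1 by rewrite invr_gt0.
  by have [n []] := filter_ex (filterI Um (unif _ k0)); exists n.
pose F k := projT1 (choice (pick k)).
have FP k := projT2 (choice (pick k)).
pose s := fix s k := if k is k'.+1 then F k (s k') else F 0%N 0%N.
have sP k : forall w, `|u (s k) w - l w| <= k.+1%:R^-1.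
  by case: k => [|k] /=; [case: (FP 0%N 0%N)|case: (FP k.+1 (s k))].
exists s, l; split.
  apply: homo_ltn; first exact: ltn_trans.
  by move=> k /=; case: (FP k.+1 (s k)).
move=> e e0; exists (Num.trunc e^-1) => k w Nk.
rewrite (le_trans (sP k w))//.
rewrite -[leRHS]invrK lef_pV2 ?posrE ?invr_gt0//.
rewrite ltW// (lt_le_trans (truncnS_gt _))// ler_nat ltnS//.
Qed.

End uniform_subsequence.

(** * The compressed convolution operator on bounded sets *)

Section dot_product.
Context {R : realType} (A : R) (hA : 1 < A).
Implicit Types (f g h : R -> R) (v w x : R) (N : R).
Local Notation RR := (measurableTypeR R).

Definition dot f g : R := (\int[haar]_(x in Rpos) (f x * g x))%R.

Lemma dotC f g : dot f g = dot g f.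
Proof. by apply: eq_Rintegral => x _; rewrite mulrC. Qed.

Lemma L2r_lin f g (p q : R) : L2r A f -> L2r A g ->
  L2r A (fun x => p * f x + q * g x).
Proof.
move=> /[dup] Lf [mf jf f0] /[dup] Lg [mg jg g0].
have mZ (k : R) (h : R -> R) : measurable_fun [set: R] h ->
    measurable_fun [set: R] (fun x => k * h x).
  by move=> mh; apply: measurable_funM => //; exact: measurable_cst.
split.
- by apply: measurable_funD; exact: mZ.
- have if2 := integrableZl measurableT (2 * p ^+ 2) jf.
  have ig2 := integrableZl measurableT (2 * q ^+ 2) jg.
  apply: (le_integrable _ _ _ (integrableD measurableT if2 ig2)) => //.
    by apply/measurable_EFinP/measurable_funX/measurable_funD; exact: mZ.
  move=> x _ /=; rewrite lee_fin normrX real_normK ?num_real//.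
  rewrite (le_trans _ (ler_norm _))//.
  have := sqr_ge0 (p * f x - q * g x); rewrite sqrrB sqrrD !exprMn.
  rewrite -(mulrA 2 (p ^+ 2)) -(mulrA 2 (q ^+ 2)).
  by move: (p ^+ 2 * f x ^+ 2) (q ^+ 2 * g x ^+ 2) (p * f x * (q * g x)) => ? ? ?; lra.
- by move=> x xA; rewrite f0// g0// !mulr0 addr0.
Qed.

Lemma integrable_dot f g : L2r A f -> L2r A g ->
  haar.-integrable (Rpos : set RR) (fun x => (f x * g x)%:E).
Proof.
move=> Lf Lg; apply: (integrableS measurableT) (L2r_integrableM Lf Lg) => //.
exact: measurable_Rpos.
Qed.

Lemma dot_linr f g h (p q : R) : L2r A f -> L2r A g -> L2r A h ->
  dot f (fun x => p * g x + q * h x) = p * dot f g + q * dot f h.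
Proof.
move=> Lf Lg Lh; have mR := @measurable_Rpos R.
have ig := integrable_dot Lf Lg; have ih := integrable_dot Lf Lh.
rewrite /dot -!RintegralZl//.
rewrite -RintegralD//.
- by apply: eq_Rintegral => x _; ring.
- exact: (integrableZl mR p ig).
- exact: (integrableZl mR q ih).
Qed.

Lemma dot_ge0 f : 0 <= dot f f.
Proof. by apply: Rintegral_ge0 => x _; rewrite -expr2 sqr_ge0. Qed.

(** From |x| <= 1 + x^2, sqrt I having finite measure.  It turns a bound on the
    L^2 norm into one on the L^1 norm. *)
Lemma norm1_le f : L2r A f ->
  (\int[haar]_x `|f x| <= \int[haar]_x ind_sqrtI A x + dot f f)%R.
Proof.
move=> /[dup] Lf [mf jf f0].
have -> : dot f f = (\int[haar]_x (f x ^+ 2))%R.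
  by rewrite /dot Rintegral_haar_Rpos//; exact: measurable_funM.
rewrite -RintegralD//; last exact: integrable_ind_sqrtI.
apply: le_Rintegral => //.
- exact: (integrable_norm (L2r_integrable hA Lf)).
- exact: (integrableD measurableT (integrable_ind_sqrtI hA) jf).
- by move=> x _; exact: L2r_norm_le.
Qed.

Lemma dot_uniform_le f (e : R) : L2r A f -> (forall x, `|f x| <= e) ->
  dot f f <= e ^+ 2 * (\int[haar]_x ind_sqrtI A x)%R.
Proof.
move=> /[dup] Lf [mf jf f0] fe.
rewrite /dot Rintegral_haar_Rpos; last exact: measurable_funM.
rewrite -RintegralZl//; last exact: integrable_ind_sqrtI.
apply: le_Rintegral => //.
- exact: (integrableZl measurableT (e ^+ 2) (integrable_ind_sqrtI hA)).
- move=> x _; have [xA|xA] := pselect (sqrtI A x); last first.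
    by rewrite f0// ind_sqrtI_out// !mulr0.
  rewrite ind_sqrtIE// mulr1 -expr2 -(real_normK (num_real (f x))).
  by rewrite lerXn2r ?nnegrE// (le_trans _ (fe x)).
Qed.

Lemma continuous_Qdelta x : 0 < x -> {for x, continuous (@Qdelta R)}.
Proof.
move=> x0; apply: (@continuous_comp _ _ _ (fun x : R => `|ln x|) lQdelta).
  apply: (@continuous_comp _ _ _ (@ln R) (@Num.norm R R)).
    exact: continuous_ln.
  exact: norm_continuous.
exact: continuous_lQdelta.
Qed.

(** For v in sqrt I, |w/v - w'/v| <= sqrt A |w - w'|, and Q delta is uniformly
    continuous on I. *)
Lemma conv_op_equicontinuous N (e : R) : 0 <= N -> 0 < e ->
  exists2 d, 0 < d & forall g w w', L2r A g -> (\int[haar]_x `|g x| <= N)%R ->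
    sqrtI A w -> sqrtI A w' -> `|w - w'| < d ->
    `|conv_op A g w - conv_op A g w'| <= e.
Proof.
move=> N0 e0; have A0 : 0 < A by exact: lt_trans hA.
have sA0 : 0 < Num.sqrt A by rewrite sqrtr_gt0.
pose e' := e / (N + 1); have e'0 : 0 < e' by rewrite divr_gt0// ltr_wpDl.
have [||d d0 dP] := @uniformly_continuous_itv R (@Qdelta R) A^-1 A e' => //.
  move=> x /andP[Ax _]; apply: continuous_Qdelta.
  by rewrite (lt_le_trans _ Ax)// invr_gt0.
exists (d / Num.sqrt A); first by rewrite divr_gt0.
move=> g w w' /[dup] Lg [mg _ g0] gN wA w'A ww'.
rewrite !conv_opE// -RintegralB//; try exact: integrable_conv_op.
have iB := integrableB measurableT (integrable_conv_op hA w Lg)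
  (integrable_conv_op hA w' Lg).
rewrite (le_trans (le_normr_Rintegral _ iB))//.
have iN := integrable_norm (L2r_integrable hA Lg).
apply: (@le_trans _ _ (e' * \int[haar]_x `|g x|)%R); last first.
  rewrite (le_trans (ler_wpM2l (ltW e'0) gN))// /e' mulrAC ler_pdivrMr ?ltr_wpDl//.
  by rewrite ler_wpM2l ?(ltW e0)// lerDl.
rewrite -RintegralZl//; apply: le_Rintegral => //.
- exact: (integrable_norm iB).
- exact: (integrableZl measurableT e' iN).
move=> v _; have key (x y : R) : (sqrtI A v -> `|x - y| <= e') ->
    `|g v * x - g v * y| <= e' * `|g v|.
  move=> xy; rewrite -mulrBr normrM mulrC.
  have [/xy vxy|vA] := pselect (sqrtI A v); first exact: ler_wpM2r.
  by rewrite (g0 v vA) normr0 !mulr0.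
apply: le_trans (key (Qdelta (w / v)) (Qdelta (w' / v)) _).
  by rewrite le_eqVlt; apply/orP; left; apply/eqP; congr (`|_ - _|);
    exact: Qtrunc_kernel.
move=> vA; apply: dP; first exact: sqrtI_div.
have v0 := sqrtI_gt0 hA vA.
rewrite -mulrBl normrM normfV (gtr0_norm v0) ltr_pdivrMr//.
rewrite (lt_le_trans ww')// ler_pM2l//.
by move: vA; rewrite /sqrtI/= in_itv/= => /andP[].
Qed.

Lemma conv_op_subsequence (g : nat -> R -> R) N : 0 <= N ->
  (forall n, L2r A (g n)) -> (forall n, (\int[haar]_x `|g n x| <= N)%R) ->
  exists (s : nat -> nat) (l : R -> R), [/\ {homo s : m n / (m < n)%N}, L2r A l &
    forall e : R, 0 < e -> exists n, forall k w, (n <= k)%N ->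
      `|conv_op A (g (s k)) w - l w| <= e].
Proof.
move=> N0 Lg gN; have [C C0 QC] := Qtrunc_bdd hA.
have uB n w : `|conv_op A (g n) w| <= C * N.
  rewrite (le_trans (conv_op_le hA w (Lg n) QC))//.
  by rewrite ler_wpM2l.
have inI w : (Num.sqrt A)^-1 <= w <= Num.sqrt A = sqrtI A w :> Prop.
  by rewrite /sqrtI/= in_itv.
have outI w : ~~ ((Num.sqrt A)^-1 <= w <= Num.sqrt A) -> ~ sqrtI A w.
  by move=> /negP h h'; apply: h; rewrite inI.
have uout n w : ~~ ((Num.sqrt A)^-1 <= w <= Num.sqrt A) ->
    conv_op A (g n) w = 0.
  by move=> /outI; exact: conv_op_out.
have [|s [l [sh sl]]] := uniform_subsequence uB uout.
  move=> e e0; have [d d0 dP] := conv_op_equicontinuous N0 e0.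
  by exists d => // n w w'; rewrite !inI => wA w'A; exact: dP.
exists s, l; split=> //.
have cvl w : (fun k => conv_op A (g (s k)) w) @ \oo --> l w.
  apply/cvgrPdist_le => e e0; have [n nP] := sl e e0.
  by exists n => // k nk; rewrite distrC; exact: nP.
apply: (@L2r_bdd _ _ hA l (C * N)).
- apply: (measurable_fun_cvg (h := fun k => conv_op A (g (s k)))).
    by move=> k; exact: measurable_conv_op.
  by move=> w _; exact: cvl.
- move=> w; apply/ler_addgt0Pl => e e0; have [n nP] := sl e e0.
  have := nP n w (leqnn n); have := uB (s n) w.
  by rewrite !ler_norml => /andP[? ?] /andP[? ?]; apply/andP; split; lra.
- move=> w wA; apply/eqP; rewrite -normr_le0; apply/ler_addgt0Pl => e e0.
  have [n nP] := sl e e0; have := nP n w (leqnn n).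
  by rewrite conv_op_out// sub0r normrN addr0.
Qed.

Lemma conv_op_lin f g (p q : R) : L2r A f -> L2r A g ->
  conv_op A (fun x => p * f x + q * g x) =
  (fun w => p * conv_op A f w + q * conv_op A g w).
Proof.
move=> Lf Lg; apply/funext => w.
have [wA|wA] := pselect (sqrtI A w); last by rewrite !conv_op_out// !mulr0 addr0.
rewrite !conv_opE//; last exact: L2r_lin.
have jf := integrable_conv_op hA w Lf; have jg := integrable_conv_op hA w Lg.
rewrite -!RintegralZl// -RintegralD//.
- by apply: eq_Rintegral => v _; ring.
- exact: (integrableZl measurableT p jf).
- exact: (integrableZl measurableT q jg).
Qed.

Lemma conv_op_ae f g : L2r A f -> L2r A g ->
  {ae (haar : {measure set RR -> \bar R}), forall x, f x = g x} -> conv_op A f = conv_op A g.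
Proof.
move=> Lf Lg fg; apply/funext => w.
have [wA|wA] := pselect (sqrtI A w); last by rewrite !conv_op_out.
rewrite !conv_opE// /Rintegral; congr fine.
apply: ae_eq_integral => //.
- exact: (measurable_int _ (integrable_conv_op hA w Lf)).
- exact: (measurable_int _ (integrable_conv_op hA w Lg)).
- by move: fg; apply: negligibleS => x h fgx; apply: h => _; rewrite fgx.
Qed.

End dot_product.

(** * The complex operator and the theorem *)

Section complex_operator.
Context {R : realType} (A : R) (hA : 1 < A).
Implicit Types (xi eta : R -> R[i]) (c : R[i]).
Local Notation RR := (measurableTypeR R).

Definition ReF xi (x : R) : R := complex.Re (xi x).
Definition ImF xi (x : R) : R := complex.Im (xi x).

Lemma L2P xi : L2 A xi <-> L2r A (ReF xi) /\ L2r A (ImF xi).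
Proof.
split=> [[rx ix xi0]|[/L2rP[rx rx0] /L2rP[ix ix0]]].
  by split; apply/L2rP; split=> // x xA; rewrite /ReF /ImF xi0.
split=> // x xA; have := rx0 x xA; have := ix0 x xA.
by rewrite /ReF /ImF; case: (xi x) => a b /= -> ->.
Qed.

Lemma Re_conjM (x y : R[i]) : complex.Re (conjc x * y) =
  complex.Re x * complex.Re y + complex.Im x * complex.Im y.
Proof. by case: x y => a b [c d] /=; ring. Qed.

Lemma Im_conjM (x y : R[i]) : complex.Im (conjc x * y) =
  complex.Re x * complex.Im y - complex.Im x * complex.Re y.
Proof. by case: x y => a b [c d] /=; ring. Qed.

Lemma innerE xi eta : L2 A xi -> L2 A eta -> inner xi eta =
  Complex (dot (ReF xi) (ReF eta) + dot (ImF xi) (ImF eta))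
          (dot (ReF xi) (ImF eta) - dot (ImF xi) (ReF eta)).
Proof.
move=> /L2P[rx ix] /L2P[re ie]; rewrite /inner /Cintegral.
have mR := @measurable_Rpos R.
congr Complex.
- rewrite /dot -(RintegralD mR (integrable_dot rx re) (integrable_dot ix ie)).
  by apply: eq_Rintegral => x _; rewrite Re_conjM.
- rewrite /dot -(RintegralB mR (integrable_dot rx ie) (integrable_dot ix re)).
  by apply: eq_Rintegral => x _; rewrite Im_conjM.
Qed.

Lemma L2normE xi : L2 A xi ->
  L2norm xi = Num.sqrt (dot (ReF xi) (ReF xi) + dot (ImF xi) (ImF xi)).
Proof. by move=> Lx; rewrite /L2norm innerE. Qed.

Lemma L2norm_sqr xi : L2 A xi ->
  L2norm xi ^+ 2 = dot (ReF xi) (ReF xi) + dot (ImF xi) (ImF xi).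
Proof. by move=> Lx; rewrite L2normE// sqr_sqrtr// addr_ge0// dot_ge0. Qed.

Definition conv_opC xi (w : R) : R[i] :=
  Complex (conv_op A (ReF xi) w) (conv_op A (ImF xi) w).

Lemma L2_conv_opC xi : L2 A xi -> L2 A (conv_opC xi).
Proof. by move=> /L2P[rx ix]; apply/L2P; split; exact: L2r_conv_op. Qed.

Lemma ReF_lin c xi eta : ReF (fun x => c * xi x + eta x) =
  (fun x => 1 * (complex.Re c * ReF xi x + - complex.Im c * ImF xi x) +
            1 * ReF eta x).
Proof.
apply/funext => x; rewrite /ReF /ImF.
by case: c (xi x) (eta x) => a b [p q] [u v] /=; ring.
Qed.

Lemma ImF_lin c xi eta : ImF (fun x => c * xi x + eta x) =
  (fun x => 1 * (complex.Re c * ImF xi x + complex.Im c * ReF xi x) +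
            1 * ImF eta x).
Proof.
apply/funext => x; rewrite /ReF /ImF.
by case: c (xi x) (eta x) => a b [p q] [u v] /=; ring.
Qed.

Lemma L2_lin c xi eta : L2 A xi -> L2 A eta -> L2 A (fun x => c * xi x + eta x).
Proof.
move=> /L2P[rx ix] /L2P[re ie]; apply/L2P; rewrite ReF_lin ImF_lin.
by split; apply: L2r_lin => //; exact: L2r_lin.
Qed.

Lemma conv_opC_lin c xi eta : L2 A xi -> L2 A eta ->
  conv_opC (fun x => c * xi x + eta x) =
  (fun x => c * conv_opC xi x + conv_opC eta x).
Proof.
move=> /L2P[rx ix] /L2P[re ie]; apply/funext => w; rewrite /conv_opC.
rewrite ReF_lin ImF_lin !(conv_op_lin hA)//; try exact: L2r_lin.
by case: c => a b /=; congr Complex; ring.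
Qed.

Lemma conv_opC_operator : L2_operator A conv_opC.
Proof.
split.
- exact: L2_conv_opC.
- move=> xi eta /L2P[rx ix] /L2P[re ie] xe; apply: aeW => w.
  rewrite /conv_opC (conv_op_ae hA rx re) ?(conv_op_ae hA ix ie)//.
  + by move: xe; apply: negligibleS => x h /= xex; apply: h; rewrite /= /ReF /ImF xex.
  + by move: xe; apply: negligibleS => x h /= xex; apply: h; rewrite /= /ReF /ImF xex.
- by move=> c xi eta Lx Le; rewrite conv_opC_lin//; apply: aeW.
Qed.

(** The real and imaginary parts converge uniformly along successive
    subsequences, hence in L^2. *)
Lemma conv_opC_compact : compact_operator A conv_opC.
Proof.
split; first exact: conv_opC_operator.
move=> xi Lxi [M xiM].
have Lr n : L2r A (ReF (xi n)) by case/L2P: (Lxi n).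
have Li n : L2r A (ImF (xi n)) by case/L2P: (Lxi n).
pose H : R := (\int[haar]_x ind_sqrtI A x)%R.
have H0 : 0 <= H by apply: Rintegral_ge0 => x _; rewrite /ind_sqrtI indicE.
pose N : R := H + M ^+ 2.
have N0 : 0 <= N by rewrite addr_ge0// sqr_ge0.
have dM n : dot (ReF (xi n)) (ReF (xi n)) + dot (ImF (xi n)) (ImF (xi n)) <= M ^+ 2.
  rewrite -L2norm_sqr// lerXn2r// ?nnegrE ?sqrtr_ge0//.
  by rewrite (le_trans _ (xiM n))// sqrtr_ge0.
have Nr n : (\int[haar]_x `|ReF (xi n) x| <= N)%R.
  rewrite (le_trans (norm1_le hA (Lr n)))// lerD2l (le_trans _ (dM n))//.
  by rewrite lerDl dot_ge0.
have Ni n : (\int[haar]_x `|ImF (xi n) x| <= N)%R.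
  rewrite (le_trans (norm1_le hA (Li n)))// lerD2l (le_trans _ (dM n))//.
  by rewrite lerDr dot_ge0.
have [s [l [sh Ll sl]]] := conv_op_subsequence hA N0 Lr Nr.
have [t [k [th Lk tk]]] := conv_op_subsequence hA N0
  (fun n => Li (s n)) (fun n => Ni (s n)).
have tn n : (n <= t n)%N.
  by elim: n => // n IH; rewrite (leq_ltn_trans IH)// th.
exists (s \o t), (fun x => Complex (l x) (k x)); split.
- by move=> m n mn; rewrite /= sh// th.
- exact/L2P.
apply/cvgrPdist_le => e e0.
(* A uniform error d on each part gives a squared L^2 error of at most 2 d^2 H,
   which is less than (d (1 + 2 H))^2 = e^2. *)
have H1 : 0 < 1 + 2 * H by rewrite ltr_pwDl// mulr_ge0.
have [d d0 dE] : exists2 d, 0 < d & e = d * (1 + 2 * H).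
  by exists (e / (1 + 2 * H)); rewrite ?divr_gt0// divfK// gt_eqF.
have [n1 n1P] := sl d d0; have [n2 n2P] := tk d d0.
exists (maxn n1 n2) => // n /=; rewrite geq_max => /andP[nn1 nn2].
rewrite sub0r normrN ger0_norm ?sqrtr_ge0//.
pose z (x : R) := conv_opC (xi (s (t n))) x - Complex (l x) (k x).
rewrite -[X in X <= _]/(L2norm z).
have zr : ReF z = (fun x => 1 * conv_op A (ReF (xi (s (t n)))) x + -1 * l x).
  by apply/funext => x; rewrite /ReF /z /conv_opC /= mul1r mulN1r.
have zi : ImF z = (fun x => 1 * conv_op A (ImF (xi (s (t n)))) x + -1 * k x).
  by apply/funext => x; rewrite /ImF /z /conv_opC /= mul1r mulN1r.
have Lzr : L2r A (ReF z).
  by rewrite zr; apply: L2r_lin => //; exact: L2r_conv_op.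
have Lzi : L2r A (ImF z).
  by rewrite zi; apply: L2r_lin => //; exact: L2r_conv_op.
have bzr : forall x, `|ReF z x| <= d.
  by move=> x; rewrite zr mul1r mulN1r n1P// (leq_trans nn1).
have bzi : forall x, `|ImF z x| <= d.
  by move=> x; rewrite zi mul1r mulN1r n2P.
rewrite L2normE; last exact/L2P.
rewrite -(ler_pXn2r (ltn0Sn 1)) ?nnegrE ?sqrtr_ge0 ?(ltW e0)//.
rewrite sqr_sqrtr ?addr_ge0 ?dot_ge0//.
have h1 := dot_uniform_le hA Lzr bzr; have h2 := dot_uniform_le hA Lzi bzi.
rewrite (le_trans (lerD h1 h2))// -/H.
rewrite dE exprMn -[X in X <= _]mulrDr; apply: ler_wpM2l; first exact: sqr_ge0.
by nra.
Qed.

Lemma corr_mulconv xi r : L2 A xi ->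
  mulconv xi (star xi) r^-1 =
  Complex (corr (ReF xi) (ReF xi) r + corr (ImF xi) (ImF xi) r)
          (corr (ImF xi) (ReF xi) r - corr (ReF xi) (ImF xi) r).
Proof.
move=> /L2P[rx ix]; rewrite /mulconv /Cintegral.
have mR := @measurable_Rpos R.
have ic f g : L2r A f -> L2r A g ->
    haar.-integrable (Rpos : set RR) (EFin \o (fun v => f v * g (v * r))).
  move=> Lf Lg; apply: (integrableS measurableT) (integrable_corr hA r Lf Lg) => //.
have E v : star xi (r^-1 / v) = conjc (xi (v * r)).
  by rewrite /star invfM !invrK mulrC.
congr Complex.
- rewrite /corr -(RintegralD mR (ic _ _ rx rx) (ic _ _ ix ix)).
  apply: eq_Rintegral => v _; rewrite E /ReF /ImF.
  by case: (xi v) (xi (v * r)) => a b [c d] /=; ring.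
- rewrite /corr -(RintegralB mR (ic _ _ ix rx) (ic _ _ rx ix)).
  apply: eq_Rintegral => v _; rewrite E /ReF /ImF.
  by case: (xi v) (xi (v * r)) => a b [c d] /=; ring.
Qed.

End complex_operator.

Section pairing.
Context {R : realType} (A : R) (hA : 1 < A).
Variables (mu nu : {measure set (measurableTypeR R) -> \bar R}).
Hypothesis Qmn : is_Qdelta mu nu.
Implicit Types (f g h : R -> R).

Lemma Qdelta_pairing f : bdd_supp f ->
  (\int[mu]_(r in Rpos) f r - \int[nu]_(r in Rpos) f r =
   - 2 * f 1 + \int[haar]_(r in Rpos) (f r * Qdelta r))%R.
Proof.
move=> bf; rewrite -reference_pairing//.
exact: Qdelta_unique Qmn is_Qdelta_reference bf.
Qed.

Lemma corr_pairing f g h k (c : R) : L2r A f -> L2r A g -> L2r A h -> L2r A k ->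
  (\int[mu]_(r in Rpos) (corr f g r + c * corr h k r) -
   \int[nu]_(r in Rpos) (corr f g r + c * corr h k r) =
   - 2 * (dot f g + c * dot h k) +
   (dot g (conv_op A f) + c * dot k (conv_op A h)))%R.
Proof.
move=> Lf Lg Lh Lk.
have bfg := bdd_supp_corr hA Lf Lg; have bhk := bdd_supp_corr hA Lh Lk.
rewrite Qdelta_pairing; last exact: bdd_supp_lin.
rewrite !corr1; congr (_ + _).
rewrite /dot -!(integral_corr_Qdelta hA)//.
have mR := @measurable_Rpos R.
have lQ := @locally_bdd_Qdelta R.
have j1 := bdd_supp_integrable (@haar_locally_finite R) (bdd_suppM bfg lQ) mR.
have j2 := bdd_supp_integrable (@haar_locally_finite R) (bdd_suppM bhk lQ) mR.
rewrite -RintegralZl// -RintegralD//; last exact: (integrableZl mR c j2).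
by apply: eq_Rintegral => r _; rewrite mulrDl mulrA.
Qed.

End pairing.

Theorem theorem3p6 (R : realType) (A : R) (hA : 1 < A) :
  (exists mu nu : {measure set (measurableTypeR R) -> \bar R},
      is_Qdelta mu nu) /\
  exists K : (R -> R[i]) -> (R -> R[i]),
    compact_operator A K /\
    forall mu nu : {measure set (measurableTypeR R) -> \bar R},
      is_Qdelta mu nu ->
    forall xi : R -> R[i], L2 A xi ->
      DQ mu nu (mulconv xi (star xi)) =
        inner xi (fun x => - 2 * xi x + K xi x) /\
      inner xi (fun x => - 2 * xi x + K xi x) =
        - 2 * (real_complex R (L2norm xi)) ^+ 2 + inner xi (K xi).
Proof.
split; first by exists muQ, nuQ; exact: is_Qdelta_reference.
exists (conv_opC A); split; first exact: conv_opC_compact.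
move=> mu nu Qmn xi Lxi.
have [rx ix] := (L2P A xi).1 Lxi.
have LK := L2_conv_opC hA Lxi.
have L2K := L2_lin (- 2) Lxi LK.
have rK := L2r_conv_op hA rx; have iK := L2r_conv_op hA ix.
have twoE : (- 2 : R[i]) = Complex (- 2) 0.
  by rewrite -[RHS]/(real_complex R (- 2)) rmorphN rmorph_nat.
have RE : ReF (fun x => - 2 * xi x + conv_opC A xi x) =
    (fun x => - 2 * ReF xi x + 1 * conv_op A (ReF xi) x).
  by rewrite ReF_lin twoE /=; apply/funext => x; rewrite /ReF /conv_opC /=; ring.
have IE : ImF (fun x => - 2 * xi x + conv_opC A xi x) =
    (fun x => - 2 * ImF xi x + 1 * conv_op A (ImF xi) x).
  by rewrite ImF_lin twoE /=; apply/funext => x; rewrite /ImF /conv_opC /=; ring.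
have innE : inner xi (fun x => - 2 * xi x + conv_opC A xi x) =
    Complex (- 2 * (dot (ReF xi) (ReF xi) + dot (ImF xi) (ImF xi)) +
      (dot (ReF xi) (conv_op A (ReF xi)) + dot (ImF xi) (conv_op A (ImF xi))))
     (dot (ReF xi) (conv_op A (ImF xi)) - dot (ImF xi) (conv_op A (ReF xi))).
  rewrite (@innerE _ A)// RE IE !(@dot_linr _ A)// (dotC (ImF xi) (ReF xi)).
  have alg (a b p q s t u : R) :
      Complex (- 2 * a + 1 * p + (- 2 * b + 1 * q))
              (- 2 * u + 1 * s - (- 2 * u + 1 * t)) =
      Complex (- 2 * (a + b) + (p + q)) (s - t).
    by congr Complex; ring.
  exact: alg.
split.
- rewrite innE /DQ /Cintegral; apply/eqP; rewrite eq_complex /=.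
  apply/andP; split; apply/eqP.
  + have := corr_pairing hA Qmn 1 rx rx ix ix; rewrite !mul1r => <-.
    by congr (_ - _); apply: eq_Rintegral => r _; rewrite mul1r;
      exact: (congr1 (@complex.Re R) (corr_mulconv hA r Lxi)).
  + have := corr_pairing hA Qmn (-1) ix rx rx ix.
    rewrite !mulN1r (dotC (ImF xi)) subrr mulr0 add0r => <-.
    by congr (_ - _); apply: eq_Rintegral => r _; rewrite mulN1r;
      exact: (congr1 (@complex.Im R) (corr_mulconv hA r Lxi)).
- rewrite innE (@innerE _ A)// -rmorphXn (@L2norm_sqr _ A)// twoE.
  have alg (n x y : R) : Complex (- 2 * n + x) y =
      Complex (- 2) 0 * real_complex R n + Complex x y.
    by apply/eqP; rewrite eq_complex /=; apply/andP; split; apply/eqP; ring.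
  exact: alg.
Qed.
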